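(* Let $k$ be an algebraically closed field of characteristic $p>0$, let $\mathcal{E}$ be an elementary abelian group scheme over $k$, and let $j\in\{1,\ldots,p-1\}$. If $M$ is a finite-dimensional $\mathcal{E}$-module of constant $j$-rank, with dual $\mathcal{E}$-module $M^\ast$, then \[ \deg^j(M)+\deg^j(M^\ast)=j\,\mathrm{rk}^j(M).\]
   Context: $k\mathcal{E}=k[\mathcal{E}]^\ast$ is the algebra of measures of $\mathcal{E}$; $\mathcal{E}$-modules are $k\mathcal{E}$-modules; $M^\ast$ is formed via the antipode of the Hopf algebra $k\mathcal{E}$; for $u\in k\mathcal{E}$, $u_M$ is the operator $m\mapsto um$ on $M$. An abelian finite group scheme $\mathcal{E}$ is elementary abelian if it is a product $\mathcal{E}=\mathcal{E}_1\cdots\mathcal{E}_n$ of subgroups, each isomorphic to a Frobenius kernel $\mathbb{G}_{a(r_i)}$ of the additive group or to the constant group $\mathbb{Z}/(p)$. Then $k\mathcal{E}$ is isomorphic, as an algebra, to a truncated polynomial ring $k[X_1,\ldots,X_s]/(X_1^p,\ldots,X_s^p)$. Let $\mathfrak{A}_p=k[T]/(T^p)$, $t=T+(T^p)$. A $p$-point of $\mathcal{E}$ is an algebra homomorphism $\alpha:\mathfrak{A}_p\to k\mathcal{E}$ making $k\mathcal{E}$ a projective $\mathfrak{A}_p$-module; via $\alpha\mapsto\alpha(t)$, the $p$-points correspond to the elements of $\mathrm{Rad}(k\mathcal{E})\setminus\mathrm{Rad}^2(k\mathcal{E})$. $\mathrm{rk}^j(M)$ is the maximum of $\mathrm{rk}(\alpha(t)_M^j)$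 over all $p$-points, and $M$ has constant $j$-rank if $\mathrm{rk}(\alpha(t)_M^j)=\mathrm{rk}^j(M)$ for all $p$-points $\alpha$. Degree of a morphism: if $U\subseteq\mathbb{P}^n$ is non-empty open and $\varphi:U\to\mathbb{P}^m$ is a morphism, there are homogeneous polynomials $f_0,\ldots,f_m\in k[X_0,\ldots,X_n]$ of the same degree $d$ with $\gcd(f_0,\ldots,f_m)=1$ and $\varphi(x)=(f_0(x):\cdots:f_m(x))$ for all $x\in U$; they are unique up to a common non-zero scalar, and $\deg(\varphi):=d$. Degree of a module $M$ of constant $j$-rank $d$: let $U_{\mathcal{E}}=\{[u]\in\mathbb{P}(\mathrm{Rad}(k\mathcal{E})) : u\notin\mathrm{Rad}^2(k\mathcal{E})\}$, a dense open subset of the projective space $\mathbb{P}(\mathrm{Rad}(k\mathcal{E}))$, and let $\mathrm{Im}^j_M:U_{\mathcal{E}}\to\mathrm{Gr}_d(M)$, $[u]\mapsto\mathrm{im}(u_M^j)$, a morphism to the Grassmannian of $d$-dimensional subspaces. Then $\deg^j(M):=\deg(\mathrm{pl}_M\circ\mathrm{Im}^j_M)$, where $\mathrm{pl}_M:\mathrm{Gr}_d(M)\to\mathbb{P}(\bigwedge^d M)$ is the Plücker embedding ($\deg^j(M)=0$ if $d=0$).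
   Formalization: The case where kE is isomorphic to k[X]/(X^p) (s = 1) is excluded, since there the formula fails: for M = kE both degrees are 0 while j·rk^j(M) = j(p−j) > 0. *)

(* Defs.v *)
From HB Require Import structures.
From mathcomp Require Import ssreflect ssrfun ssrbool eqtype ssrnat seq choice.
From mathcomp Require Import fintype finfun tuple bigop div prime binomial.
From mathcomp Require Import fingroup ssralg zmodp poly polydiv qpoly matrix.
From mathcomp Require Import vector falgebra mpoly.
From Stdlib Require Import ClassicalEpsilon.

Set Implicit Arguments.
Unset Strict Implicit.
Unset Printing Implicit Defensive.

Import GRing.Theory.
Local Open Scope ring_scope.

(* U (x) V, as matrices of coordinates in the bases vbasis {:U}, vbasis {:V}. *)
Definition tens (k : fieldType) (U V : vectType k) : Type :=
  'M[k]_(\dim {:U}, \dim {:V}).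

HB.instance Definition _ (k : fieldType) (U V : vectType k) :=
  Vector.copy (tens U V) 'M[k]_(\dim {:U}, \dim {:V}).

Section Tensor.
Variable k : fieldType.
Implicit Types U V W X : vectType k.

Definition pureT U V (u : U) (v : V) : tens U V :=
  \matrix_(i, j) (coord (vbasis {:U}) i u * coord (vbasis {:V}) j v).

(* The linear map U (x) V -> W induced by B, when B is bilinear: with Sweedler's
   t = sum a (x) b, liftT B t is sum B a b. *)
Definition liftT U V W (B : U -> V -> W) (t : tens U V) : W :=
  \sum_i \sum_j (t : 'M_(_, _)) i j *: B (vbasis {:U})`_i (vbasis {:V})`_j.

Definition bilin U V W (B : U -> V -> W) : Prop :=
  (forall v, linear (B^~ v)) /\ (forall u, linear (B u)).

Fact liftT_linear U V W (B : U -> V -> W) : linear (liftT B).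
Proof.
move=> a s t; rewrite /liftT scaler_sumr -big_split /=; apply: eq_bigr => i _.
rewrite scaler_sumr -big_split /=; apply: eq_bigr => j _.
by rewrite !mxE scalerDl scalerA.
Qed.
HB.instance Definition _ U V W (B : U -> V -> W) :=
  GRing.isLinear.Build k (tens U V) W _ (liftT B) (@liftT_linear U V W B).

Lemma liftT_pure U V W (B : U -> V -> W) u v : bilin B -> liftT B (pureT u v) = B u v.
Proof.
case=> Bl Br.
pose Bl' v' := GRing.isLinear.Build k _ _ _ (B^~ v') (Bl v').
pose Bv v' : {linear U -> W} := HB.pack (B^~ v') (Bl' v').
pose Br' u' := GRing.isLinear.Build k _ _ _ (B u') (Br u').
pose Bu u' : {linear V -> W} := HB.pack (B u') (Br' u').
rewrite [in RHS](coord_vbasis (memvf u)) [in RHS](coord_vbasis (memvf v)).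
rewrite -[B _ _]/(Bv _ _) linear_sum; apply: eq_bigr => i _.
rewrite linearZ /= -[B _ _]/(Bu _ _) linear_sum scaler_sumr.
by apply: eq_bigr => j _; rewrite linearZ /= mxE scalerA.
Qed.

Lemma pureT_bilin U V : bilin (@pureT U V).
Proof.
split=> w a x y; apply/matrixP=> i j; rewrite !mxE linearP /=.
  by rewrite mulrDl mulrA.
by rewrite mulrDr mulrCA.
Qed.

Lemma tensE U V (t : tens U V) :
  t = \sum_i \sum_j (t : 'M_(_, _)) i j *: pureT (vbasis {:U})`_i (vbasis {:V})`_j.
Proof.
have fU : free (vbasis {:U}) by exact: basis_free (vbasisP _).
have fV : free (vbasis {:V}) by exact: basis_free (vbasisP _).
apply/matrixP=> i j; rewrite summxE (bigD1 i) //= summxE (bigD1 j) //=.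
rewrite !mxE !coord_free // !eqxx !mulr1 !big1 ?addr0 //.
  move=> i' ne; rewrite summxE big1 // => j' _.
  by rewrite !mxE !coord_free // (negPf ne) eq_sym // mul0r mulr0.
move=> j' ne; rewrite !mxE !coord_free // (negPf ne) mulr0 mulr0 //.
Qed.

Lemma liftT_id U V (t : tens U V) : liftT (@pureT U V) t = t.
Proof. by rewrite [RHS]tensE. Qed.

Lemma tens_ext U V W (f g : tens U V -> W) : linear f -> linear g ->
  (forall u v, f (pureT u v) = g (pureT u v)) -> f =1 g.
Proof.
move=> lf lg fg t.
pose f' : {linear _ -> _} := HB.pack f (GRing.isLinear.Build k _ _ _ f lf).
pose g' : {linear _ -> _} := HB.pack g (GRing.isLinear.Build k _ _ _ g lg).
rewrite [t]tensE -[LHS]/(f' _) -[RHS]/(g' _) !linear_sum; apply: eq_bigr => i _.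
by rewrite !linear_sum; apply: eq_bigr => j _; rewrite !linearZ /= fg.
Qed.

Lemma eq_liftT U V W (B C : U -> V -> W) : (forall u v, B u v = C u v) -> liftT B =1 liftT C.
Proof. by move=> BC t; apply: eq_bigr => i _; apply: eq_bigr => j _; rewrite BC. Qed.

Lemma linear_liftT U V W X (B : U -> V -> W) (f : {linear W -> X}) t :
  f (liftT B t) = liftT (fun u v => f (B u v)) t.
Proof. by rewrite linear_sum; apply: eq_bigr => i _; rewrite linear_sum; apply: eq_bigr => j _; rewrite linearZ. Qed.

Lemma liftT_lincomb U V W (B C : U -> V -> W) a t :
  liftT (fun u v => a *: B u v + C u v) t = a *: liftT B t + liftT C t.
Proof.
rewrite /liftT scaler_sumr -big_split /=; apply: eq_bigr => i _.
rewrite scaler_sumr -big_split /=; apply: eq_bigr => j _.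
by rewrite scalerDr !scalerA mulrC.
Qed.

End Tensor.

Section TensAlg.
Variables (k : fieldType) (A B : falgType k).
Implicit Types s t : tens A B.

Definition mulT s t : tens A B :=
  liftT (fun a b => liftT (fun c d => pureT (a * c) (b * d)) t) s.
Definition oneT : tens A B := pureT 1 1.

Lemma pureT_mulr (a : A) (b : B) : bilin (fun c d => pureT (a * c) (b * d)).
Proof.
have [pl pr] := @pureT_bilin k A B.
split=> w x u v; rewrite mulrDr -scalerAr; [exact: pl | exact: pr].
Qed.
Lemma pureT_mull (c : A) (d : B) : bilin (fun a b => pureT (a * c) (b * d)).
Proof.
have [pl pr] := @pureT_bilin k A B.
split=> w x u v; rewrite mulrDl -scalerAl; [exact: pl | exact: pr].
Qed.

Fact mulT_linear_r s : linear (mulT s).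
Proof.
move=> a t u; rewrite /mulT -liftT_lincomb; apply: eq_liftT => x y; exact: linearP.
Qed.
Fact mulT_linear_l t : linear (mulT^~ t).
Proof. by move=> a s u; rewrite /mulT linearP. Qed.


Lemma mulT_pure (a c : A) (b d : B) :
  mulT (pureT a b) (pureT c d) = pureT (a * c) (b * d).
Proof.
rewrite /mulT (eq_liftT (C := fun x y => pureT (x * c) (y * d))).
  by rewrite liftT_pure //; exact: pureT_mull.
by move=> x y; rewrite liftT_pure //; exact: pureT_mulr.
Qed.

Fact mulTA : associative mulT.
Proof.
move=> s t u; move: s; apply: tens_ext => [a x y|a x y|a b].
- by rewrite mulT_linear_l.
- by rewrite !mulT_linear_l.
move: t; apply: tens_ext => [z x y|z x y|c d].
- by rewrite mulT_linear_l mulT_linear_r.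
- by rewrite mulT_linear_r mulT_linear_l.
move: u; apply: tens_ext => [z x y|z x y|e f].
- by rewrite !mulT_linear_r.
- by rewrite !mulT_linear_r.
by rewrite !mulT_pure !mulrA.
Qed.

Fact mul1T : left_id oneT mulT.
Proof.
apply: tens_ext => [z x y|z x y|a b] //; first by rewrite mulT_linear_r.
by rewrite mulT_pure !mul1r.
Qed.
Fact mulT1 : right_id oneT mulT.
Proof.
apply: tens_ext => [z x y|z x y|a b] //; first by rewrite mulT_linear_l.
by rewrite mulT_pure !mulr1.
Qed.
Fact mulTDl : left_distributive mulT +%R.
Proof. by move=> x y z; have := mulT_linear_l z 1 x y; rewrite !scale1r. Qed.
Fact mulTDr : right_distributive mulT +%R.
Proof. by move=> x y z; have := mulT_linear_r x 1 y z; rewrite !scale1r. Qed.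
Fact oneT_neq0 : oneT != 0.
Proof.
have nz (C : falgType k) : exists i, coord (vbasis {:C}) i 1 != 0.
  apply/existsP; apply: contraR (oner_neq0 C) => /existsPn h.
  rewrite (coord_vbasis (memvf 1)) big1 // => i _.
  by have := h i; rewrite negbK => /eqP->; rewrite scale0r.
have [i hi] := nz A; have [j hj] := nz B.
apply/eqP => /matrixP/(_ i j); rewrite !mxE => /eqP.
by rewrite mulf_eq0 (negPf hi) (negPf hj).
Qed.
HB.instance Definition _ := GRing.Zmodule_isNzRing.Build (tens A B)
  mulTA mul1T mulT1 mulTDl mulTDr oneT_neq0.
Fact scaleTAl (a : k) s t : a *: (s * t) = (a *: s) * t.
Proof. by have := mulT_linear_l t a s 0; rewrite /= addr0 (mul0r t : mulT 0 t = 0) addr0 => <-. Qed.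
HB.instance Definition _ := GRing.Lmodule_isLalgebra.Build k (tens A B) scaleTAl.
Fact scaleTAr (a : k) s t : a *: (s * t) = s * (a *: t).
Proof. by have := mulT_linear_r s a t 0; rewrite /= addr0 (mulr0 s : mulT s 0 = 0) addr0 => <-. Qed.
HB.instance Definition _ := GRing.Lalgebra_isAlgebra.Build k (tens A B) scaleTAr.
HB.instance Definition _ := Algebra_isFalgebra.Build k (tens A B).

Lemma pureTM (a c : A) (b d : B) : pureT a b * pureT c d = pureT (a * c) (b * d).
Proof. exact: mulT_pure. Qed.
Lemma pureT1 : pureT 1 1 = 1 :> tens A B.
Proof. by []. Qed.
End TensAlg.

(* A finite group scheme is given by its coordinate ring k[E], a finite
   dimensional commutative Hopf algebra. *)
Record finGroupScheme (k : fieldType) := FinGroupScheme {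
  coordRing : falgType k;
  comul : {lrmorphism coordRing -> tens coordRing coordRing};
  counit : {lrmorphism coordRing -> k^o};
  antipode : {linear coordRing -> coordRing};
  coordRing_comm : @commutative coordRing coordRing *%R;
  comul_assoc : forall f,
    liftT (fun a b => liftT (fun a1 a2 => pureT (pureT a1 a2) b) (comul a))
          (comul f) =
    liftT (fun a b => liftT (fun b1 b2 => pureT (pureT a b1) b2) (comul b))
          (comul f);
  counit_l : forall f, liftT (fun a b => (counit a : k) *: b) (comul f) = f;
  counit_r : forall f, liftT (fun a b => (counit b : k) *: a) (comul f) = f;
  antipode_l : forall f,
    liftT (fun a b => antipode a * b) (comul f) = (counit f : k)%:A;
  antipode_r : forall f,
    liftT (fun a b => a * antipode b) (comul f) = (counit f : k)%:A
}.

Section Sweedler.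
Variables (k : fieldType) (E : finGroupScheme k).
Local Notation H := (coordRing E).
Local Notation D := (comul E).
Local Notation S := (antipode E).
Local Notation e := (counit E).

Definition trilin (W : vectType k) (F : H -> H -> H -> W) : Prop :=
  [/\ forall b c, linear (fun a => F a b c), forall a c, linear (fun b => F a b c)
    & forall a b, linear (F a b)].

Lemma comul_liftA (W : vectType k) (F : H -> H -> H -> W) f : trilin F ->
  liftT (fun a b => liftT (fun a1 a2 => F a1 a2 b) (D a)) (D f) =
  liftT (fun a b => liftT (fun b1 b2 => F a b1 b2) (D b)) (D f).
Proof.
case=> F1 F2 F3.
pose P (t : tens (tens H H) H) := liftT (fun u c => liftT (fun a b => F a b c) u) t.
have PE a b c : P (pureT (pureT a b) c) = F a b c.
  rewrite /P liftT_pure; last first.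
    split=> [w z x y|w z x y]; first by rewrite linearP.
    by rewrite -liftT_lincomb; apply: eq_liftT => u v; apply: F3.
  by rewrite liftT_pure.
have := congr1 P (comul_assoc f).
rewrite /P 2!linear_liftT => h.
under eq_liftT => a b do under eq_liftT => a1 a2 do rewrite -PE.
under [RHS]eq_liftT => a b do under eq_liftT => a1 a2 do rewrite -PE.
under eq_liftT => a b do rewrite -linear_liftT.
under [RHS]eq_liftT => a b do rewrite -linear_liftT.
exact: h.
Qed.

Lemma liftT_comul_linear (W : vectType k) (B : H -> H -> W) : linear (fun f => liftT B (D f)).
Proof. by move=> a x y; rewrite !linearP. Qed.

Lemma linearDZ (V W : lmodType k) (f : V -> W) : linear f -> (forall x y, f (x + y) = f x + f y) * (forall a x, f (a *: x) = a *: f x).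
Proof.
move=> lf; pose g : {linear _ -> _} := HB.pack f (GRing.isLinear.Build k _ _ _ f lf).
by split=> *; rewrite -[f]/(g : _ -> _) (linearD, linearZ).
Qed.

Section Conv.
Variable R : falgType k.
Implicit Types x y z : H -> R.
Definition conv x y : H -> R := fun f => liftT (fun a b => x a * y b) (D f).
Lemma convA x y z : linear x -> linear y -> linear z -> conv x (conv y z) =1 conv (conv x y) z.
Proof.
move=> lx ly lz f; rewrite /conv.
under eq_liftT => a b do rewrite -[x a * _]/((x a \*o idfun) _) linear_liftT /=.
under [RHS]eq_liftT => a b do rewrite -[_ * z b]/((z b \o* idfun) _) linear_liftT /=.
under eq_liftT => a b do under eq_liftT => c d do rewrite mulrA.
rewrite -(@comul_liftA R (fun a b c => x a * y b * z c)) //.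
split=> [b c|a c|a b] t u v; rewrite ?lx ?ly ?lz.
- by rewrite !mulrDl -!scalerAl.
- by rewrite mulrDr mulrDl -scalerAr -scalerAl.
- by rewrite mulrDr -!scalerAr.
Qed.
Definition convun : H -> R := fun f => (e f : k)%:A.
Lemma conv1 x : linear x -> conv x convun =1 x.
Proof.
move=> lx f; rewrite /conv -[in RHS](counit_r f).
pose g : {linear _ -> _} := HB.pack x (GRing.isLinear.Build k _ _ _ x lx).
rewrite -[RHS]/(g _) linear_liftT; apply: eq_liftT => a b /=.
by rewrite (linearDZ lx).2 /convun -scalerAr mulr1.
Qed.
Lemma conv1l x : linear x -> conv convun x =1 x.
Proof.
move=> lx f; rewrite /conv -[in RHS](counit_l f).
pose g : {linear _ -> _} := HB.pack x (GRing.isLinear.Build k _ _ _ x lx).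
rewrite -[RHS]/(g _) linear_liftT; apply: eq_liftT => a b /=.
by rewrite (linearDZ lx).2 /convun -scalerAl mul1r.
Qed.
End Conv.

Lemma comul_antipode f : D (S f) = liftT (fun a b => pureT (S b) (S a)) (D f).
Proof.
pose R := tens H H.
pose x : H -> R := D; pose L f : R := D (S f).
pose y f : R := liftT (fun a b => pureT (S b) (S a)) (D f).
have [pl pr] := @pureT_bilin k H H.
have lx : linear x by exact: linearP.
have lL : linear L by move=> a u v; rewrite /L linearP [LHS](linearDZ lx).1 (linearDZ lx).2.
have ly : linear y by exact: liftT_comul_linear.
have Lx g : conv L x g = convun _ g.
  rewrite /conv /L /x; under eq_liftT => a b do rewrite -rmorphM.
  by rewrite -linear_liftT antipode_l linearZ /= rmorph1.
have xy g : conv x y g = convun _ g.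
  rewrite /conv.
  pose F a1 a2 b : R := liftT (fun b1 b2 => pureT (a1 * S b2) (a2 * S b1)) (D b).
  have -> : liftT (fun a b => x a * y b) (D g) =
            liftT (fun a b => liftT (fun a1 a2 => F a1 a2 b) (D a)) (D g).
    apply: eq_liftT => a b; rewrite /x -[in LHS](liftT_id (D a)).
    rewrite -[LHS]/((y b \o* idfun) _) linear_liftT /=; apply: eq_liftT => a1 a2.
    rewrite /y -[LHS]/((pureT a1 a2 \*o idfun) _) linear_liftT /=.
    by apply: eq_liftT => b1 b2; rewrite pureTM.
  rewrite comul_liftA; last first.
    split=> [b c|a c|a b] t u v; rewrite /F ?linearP //.
      rewrite -liftT_lincomb; apply: eq_liftT => *.
      by rewrite mulrDl -scalerAl pl.
    rewrite -liftT_lincomb; apply: eq_liftT => *.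
    by rewrite mulrDl -scalerAl pr.
  have -> : liftT (fun a b => liftT (fun b1 b2 => F a b1 b2) (D b)) (D g) =
            liftT (fun a b => pureT (a * S b) 1) (D g).
    apply: eq_liftT => a b.
    rewrite /F -(@comul_liftA R (fun c d1 d2 => pureT (a * S d2) (c * S d1))); last first.
      split=> [d c|d c|d c] t u v; rewrite ?linearP.
      - by rewrite mulrDl -scalerAl pr.
      - by rewrite mulrDr -scalerAr pr.
      - by rewrite mulrDr -scalerAr pl.
    pose h z : {linear _ -> _} := HB.pack (pureT (a * S z) : H -> R) (GRing.isLinear.Build k _ _ _ _ (pr (a * S z))).
    under eq_liftT => c d.
      rewrite -[liftT _ _]/(liftT (fun a1 a2 => h d (a1 * S a2)) (D c)).
      rewrite -linear_liftT antipode_r linearZ /= -[_ *: _]/((e c : k) *: (fun z => pureT (a * S z) 1) d).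
      over.
    pose m : {linear _ -> _} := HB.pack ((@pureT k H H)^~ 1) (GRing.isLinear.Build k _ _ _ _ (pl 1)).
    rewrite -[in RHS](counit_l b) !linear_liftT.
    rewrite -[RHS]/(m _) [a * _](linear_liftT _ (a \*o idfun)) linear_liftT.
    by apply: eq_liftT => c d /=; rewrite linearZ /= -scalerAr (linearDZ (pl 1)).2.
  pose m : {linear _ -> _} := HB.pack ((@pureT k H H)^~ 1) (GRing.isLinear.Build k _ _ _ _ (pl 1)).
  rewrite -[LHS]/(liftT (fun a b => m (a * S b)) (D g)) -linear_liftT antipode_r.
  by rewrite linearZ /= pureT1.
rewrite -[LHS]/(L f) -[RHS]/(y f) -(conv1 lL) -(conv1l ly).
have -> : conv L (convun R) f = conv L (conv x y) f.
  by apply: eq_liftT => a b; rewrite xy.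
rewrite convA //; by apply: eq_liftT => a b; rewrite Lx.
Qed.

Lemma antipode1 : S 1 = 1.
Proof.
have := antipode_l (1 : H); rewrite !rmorph1 scale1r liftT_pure ?mulr1 //.
split=> w z x y; first by rewrite linearP mulrDl -scalerAl.
by rewrite mulrDr -scalerAr.
Qed.
Lemma counit_antipode f : e (S f) = e f.
Proof.
have := congr1 e (antipode_l f); rewrite linearZ /= rmorph1 [X in _ = X]mulr1 => <-.
rewrite linear_liftT.
under eq_liftT => a b do rewrite rmorphM /=.
rewrite -{1}(counit_r f) !linear_liftT; apply: eq_liftT => a b.
by rewrite !linearZ /= mulrC.
Qed.
End Sweedler.

(* kE = k[E]^*, with the convolution product (u * v)(f) = sum u(f_1) v(f_2). *)
Definition measures (k : fieldType) (E : finGroupScheme k) : Type :=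
  'Hom(coordRing E, k^o).

HB.instance Definition _ (k : fieldType) (E : finGroupScheme k) :=
  Vector.copy (measures E) 'Hom(coordRing E, k^o).

Section Measures.
Variables (k : fieldType) (E : finGroupScheme k).
Local Notation H := (coordRing E).
Implicit Types u v w : measures E.

HB.instance Definition _ (x y : H -> k^o) := GRing.isLinear.Build k H k^o _
  (conv x y) (liftT_comul_linear (fun a b => x a * y b)).

Definition mulM u v : measures E := linfun (@conv k E k^o u v).
Definition oneM : measures E := linfun (counit E).

Lemma mulME u v f : (mulM u v : 'Hom(_, _)) f = conv (u : 'Hom(_,_)) (v : 'Hom(_,_)) f.
Proof. exact: lfunE. Qed.
Lemma oneME f : (oneM : 'Hom(_, _)) f = convun k^o f.
Proof. by rewrite lfunE /= /convun [RHS]mulr1. Qed.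

Fact mulMA : associative mulM.
Proof.
move=> u v w; apply/lfunP => f; rewrite !mulME.
have lin t : linear (fun_of_lfun (t : 'Hom(H, k^o))) by exact: linearP.
have -> : conv (fun_of_lfun u) (fun_of_lfun (mulM v w)) f =
          conv (fun_of_lfun u) (conv (fun_of_lfun v) (fun_of_lfun w)) f.
  by apply: eq_liftT => a b; rewrite mulME.
by rewrite convA //; apply: eq_liftT => a b; rewrite mulME.
Qed.
Fact mul1M : left_id oneM mulM.
Proof.
move=> u; apply/lfunP => f; rewrite mulME -[RHS]conv1l; last exact: linearP.
by apply: eq_liftT => a b; rewrite oneME.
Qed.
Fact mulM1 : right_id oneM mulM.
Proof.
move=> u; apply/lfunP => f; rewrite mulME -[RHS]conv1; last exact: linearP.
by apply: eq_liftT => a b; rewrite oneME.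
Qed.
Fact mulM_linl v : linear (mulM^~ v).
Proof.
move=> a x y; apply/lfunP => f; rewrite add_lfunE scale_lfunE !mulME /conv.
rewrite -liftT_lincomb; apply: eq_liftT => b c.
by rewrite add_lfunE scale_lfunE mulrDl -scalerAl.
Qed.
Fact mulM_linr u : linear (mulM u).
Proof.
move=> a x y; apply/lfunP => f; rewrite add_lfunE scale_lfunE !mulME /conv.
rewrite -liftT_lincomb; apply: eq_liftT => b c.
by rewrite add_lfunE scale_lfunE mulrDr -scalerAr.
Qed.
Fact mulMDl : left_distributive mulM +%R.
Proof. by move=> x y z; rewrite (linearDZ (mulM_linl z)).1. Qed.
Fact mulMDr : right_distributive mulM +%R.
Proof. by move=> x y z; rewrite (linearDZ (mulM_linr x)).1. Qed.
Fact oneM_neq0 : oneM != 0.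
Proof.
apply/eqP => /lfunP/(_ 1); rewrite zero_lfunE lfunE /= rmorph1 => /eqP.
by rewrite oner_eq0.
Qed.
HB.instance Definition _ := GRing.Zmodule_isNzRing.Build (measures E)
  mulMA mul1M mulM1 mulMDl mulMDr oneM_neq0.
Fact scaleMAl (a : k) u v : a *: (u * v) = (a *: u) * v.
Proof. by rewrite -[RHS]/(mulM _ _) (linearDZ (mulM_linl v)).2. Qed.
HB.instance Definition _ := GRing.Lmodule_isLalgebra.Build k (measures E) scaleMAl.
Fact scaleMAr (a : k) u v : a *: (u * v) = u * (a *: v).
Proof. by rewrite -[RHS]/(mulM _ _) (linearDZ (mulM_linr u)).2. Qed.
HB.instance Definition _ := GRing.Lalgebra_isAlgebra.Build k (measures E) scaleMAr.
HB.instance Definition _ := Algebra_isFalgebra.Build k (measures E).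

Lemma measM u v f : (u * v : 'Hom(_, _)) f =
  liftT (fun a b => ((u : 'Hom(_,_)) a * (v : 'Hom(_,_)) b : k^o)) (comul E f).
Proof. exact: mulME. Qed.
Lemma meas1 f : (1 : measures E) f = counit E f.
Proof. exact: lfunE. Qed.

Definition antipodeM u : measures E := (u \o linfun (antipode E))%VF.

Fact antipodeM_linear : linear antipodeM.
Proof. by move=> a u v; rewrite /antipodeM comp_lfunDl comp_lfunZl. Qed.
HB.instance Definition _ := GRing.isLinear.Build k (measures E) (measures E) _
  antipodeM antipodeM_linear.

Lemma antipodeM1 : antipodeM 1 = 1.
Proof. by apply/lfunP => f; rewrite comp_lfunE !meas1 lfunE /= counit_antipode. Qed.
Lemma antipodeMM u v : antipodeM (u * v) = antipodeM v * antipodeM u.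
Proof.
apply/lfunP => f; rewrite comp_lfunE !measM lfunE /= comul_antipode.
pose B (a b : H) : k^o := (u : 'Hom(_, _)) a * (v : 'Hom(_, _)) b.
have bB : bilin B.
  by split=> x z s t; rewrite /B linearP ?mulrDl ?mulrDr -?scalerAl -?scalerAr.
rewrite -[LHS]/(liftT B _) [LHS](linear_liftT _ (liftT B)).
apply: eq_liftT => a b /=; rewrite liftT_pure // /B.
by rewrite !comp_lfunE !lfunE /= [LHS]mulrC.
Qed.
End Measures.

Record emodule (k : fieldType) (E : finGroupScheme k) := EModule {
  mcarrier :> vectType k;
  mact : {linear measures E -> 'End(mcarrier)};
  mact1 : mact 1 = \1%VF;
  mactM : forall u v, mact (u * v) = (mact u \o mact v)%VF
}.

Section Dual.
Variables (k : fieldType) (E : finGroupScheme k) (M : emodule E).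

Definition dual_op (u : measures E) (phi : 'Hom(M, k^o)) : 'Hom(M, k^o) :=
  (phi \o mact M (antipodeM u))%VF.
Fact dual_op_linear u : linear (dual_op u).
Proof. by move=> a x y; rewrite /dual_op comp_lfunDl comp_lfunZl. Qed.
HB.instance Definition _ u := GRing.isLinear.Build k 'Hom(M, k^o) 'Hom(M, k^o) _
  (dual_op u) (dual_op_linear u).

Definition dual_act (u : measures E) : 'End('Hom(M, k^o)) := linfun (dual_op u).
Fact dual_act_linear : linear dual_act.
Proof.
move=> a u v; apply/lfunP => phi.
rewrite add_lfunE scale_lfunE !lfunE /= /dual_op !linearP /=.
by rewrite comp_lfunDr comp_lfunZr.
Qed.
HB.instance Definition _ := GRing.isLinear.Build k (measures E) _ _
  dual_act dual_act_linear.
Fact dual_act1 : dual_act 1 = \1%VF.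
Proof.
apply/lfunP => phi; rewrite !lfunE /= /dual_op antipodeM1 mact1.
by rewrite comp_lfun1r.
Qed.
Fact dual_actM u v : dual_act (u * v) = (dual_act u \o dual_act v)%VF.
Proof.
apply/lfunP => phi; rewrite comp_lfunE !lfunE /= /dual_op antipodeMM mactM.
by rewrite comp_lfunA.
Qed.
Definition dual_module : emodule E := EModule dual_act1 dual_actM.
End Dual.

Section AlgebraMaps.
Variables (k : fieldType) (A B R : falgType k).

Lemma liftT_multiplicative (F : A -> B -> R) : bilin F ->
  (forall a a' b b', F (a * a') (b * b') = F a b * F a' b') ->
  {morph liftT F : s t / s * t}.
Proof.
move=> bF FM s t; move: s; apply: tens_ext => [a x y|a x y|a b].
- by rewrite mulrDl -scalerAl linearP.
- by rewrite linearP mulrDl -scalerAl.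
move: t; apply: tens_ext => [z x y|z x y|a' b'].
- by rewrite mulrDr -scalerAr linearP.
- by rewrite linearP mulrDr -scalerAr.
by rewrite pureTM !liftT_pure.
Qed.
End AlgebraMaps.

(* k[X]/(X^n), for n > 0 *)
Definition truncPoly (k : fieldType) (n : nat) : Type := {poly %/ ('X^n : {poly k})}.
HB.instance Definition _ (k : fieldType) n :=
  Vector.copy (truncPoly k n) {poly %/ ('X^n : {poly k})}.
HB.instance Definition _ (k : fieldType) n :=
  GRing.ComNzRing.copy (truncPoly k n) {poly %/ ('X^n : {poly k})}.
HB.instance Definition _ (k : fieldType) n :=
  GRing.Algebra.copy (truncPoly k n) {poly %/ ('X^n : {poly k})}.
HB.instance Definition _ (k : fieldType) n :=
  Algebra_isFalgebra.Build k (truncPoly k n).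

Definition truncX (k : fieldType) n : truncPoly k n := in_qpoly ('X^n) 'X.

Section TruncPoly.
Variables (k : fieldType) (n : nat) (n_gt0 : (0 < n)%N).
Local Notation P := (truncPoly k n).
Local Notation x := (truncX k n).

Let mkX : mk_monic ('X^n : {poly k}) = 'X^n.
Proof. by rewrite /mk_monic size_polyXn ltnS n_gt0 monicXn. Qed.

Lemma truncX_nil : x ^+ n = 0.
Proof.
rewrite /truncX -[LHS]rmorphXn /=; apply/val_inj => /=.
by rewrite mkX Pdiv.RingMonic.rmodpp // monicXn.
Qed.

Definition truncEval (A : falgType k) (a : A) (f : P) : A :=
  horner_alg a (f : {poly k}).

Lemma truncPolyE (f : P) : f = \sum_(i < n) (f : {poly k})`_i *: x ^+ i.
Proof.
have sf : (size (f : {poly k}) <= n)%N.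
  by apply: leq_trans (size_npoly f) _; rewrite mkX size_polyXn.
have h : f = in_qpoly ('X^n) (f : {poly k}).
  apply/val_inj; rewrite /= Pdiv.Ring.rmodp_small //.
  by apply: leq_ltn_trans sf _; rewrite mkX size_polyXn.
rewrite {1}h -{1}(coefK (f : {poly k})) poly_def.
rewrite (big_ord_widen n (fun i => (f : {poly k})`_i *: 'X^i)) // big_mkcond /=.
rewrite -[LHS]/((in_qpoly 'X^n : {linear _ -> _}) _) linear_sum.
apply: eq_bigr => i _; case: ltnP => [|/(nth_default 0)->].
  by rewrite linearZ /= rmorphXn.
by rewrite linear0 scale0r.
Qed.

Section Eval.
Variables (A : falgType k) (a : A) (a_nil : a ^+ n = 0).

Fact truncEval_linear : linear (truncEval a).
Proof.
move=> c f g; rewrite /truncEval.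
have -> : c *: f + g = c *: (f : {poly k}) + (g : {poly k}) :> {poly k} by [].
by rewrite linearP /= mulr_algl.
Qed.

Lemma truncEval_mod (q : {poly k}) : truncEval a (in_qpoly ('X^n) q) = horner_alg a q.
Proof.
rewrite /truncEval /= mkX [in RHS](Pdiv.RingMonic.rdivp_eq (monicXn k n) q).
by rewrite rmorphD rmorphM rmorphXn /= horner_algX a_nil mulr0 add0r.
Qed.

Fact truncEval_monoid_morphism : monoid_morphism (truncEval a).
Proof.
split=> [|f g]; first by rewrite -(rmorph1 (in_qpoly ('X^n : {poly k}))) truncEval_mod rmorph1.
rewrite -[f * g]/(in_qpoly ('X^n) ((f : {poly k}) * (g : {poly k}))) truncEval_mod.
by rewrite rmorphM.
Qed.
Definition truncEvalMorph : {lrmorphism P -> A} :=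
  HB.pack (truncEval a) (GRing.isLinear.Build k P A _ _ truncEval_linear)
    (GRing.isMonoidMorphism.Build P A _ truncEval_monoid_morphism).
Lemma truncEvalX : truncEval a x = a.
Proof. by rewrite /truncX truncEval_mod horner_algX. Qed.
End Eval.

Lemma truncPoly_ext (A : falgType k) (F G : P -> A) :
  linear F -> linear G -> {morph F : u v / u * v} -> {morph G : u v / u * v} ->
  F 1 = 1 -> G 1 = 1 -> F x = G x -> F =1 G.
Proof.
move=> lF lG mF mG F1 G1 FG f.
have FX m : F (x ^+ m) = F x ^+ m.
  by elim: m => [|m IH]; rewrite ?expr0 // !exprS mF IH.
have GX m : G (x ^+ m) = G x ^+ m.
  by elim: m => [|m IH]; rewrite ?expr0 // !exprS mG IH.
pose F' : {linear _ -> _} := HB.pack F (GRing.isLinear.Build k _ _ _ F lF).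
pose G' : {linear _ -> _} := HB.pack G (GRing.isLinear.Build k _ _ _ G lG).
rewrite (truncPolyE f) -[LHS]/(F' _) -[RHS]/(G' _) !linear_sum.
by apply: eq_bigr => i _; rewrite !linearZ /= FX GX FG.
Qed.
End TruncPoly.

(* G_{a(r)}: k[X]/(X^(p^r)) with X |-> X (x) 1 + 1 (x) X, X |-> 0, X |-> - X. *)
Section FrobeniusKernel.
Variables (k : fieldType) (p : nat) (charp : p \in [pchar k]) (r : nat).
Let q := (p ^ r)%N.
Local Notation P := (truncPoly k q).
Local Notation x := (truncX k q).

Let q_gt0 : (0 < q)%N.
Proof. by rewrite expn_gt0 prime_gt0 // (pcharf_prime charp). Qed.

Let Dx : tens P P := pureT x 1 + pureT 1 x.

Lemma exprD_pchar_comm (A : falgType k) (a b : A) :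
  GRing.comm a b -> (a + b) ^+ q = a ^+ q + b ^+ q.
Proof.
have chA : p \in [pchar A] by rewrite (pchar_lalg A).
rewrite /q; elim: r a b => [|m IH] a b cab; first by rewrite expn0 !expr1.
rewrite expnS !exprM.
have := pFrobenius_autD_comm chA cab; rewrite !pFrobenius_autE => ->.
by rewrite IH //; apply: commrX; apply/commr_sym/commrX/commr_sym.
Qed.

Fact Ga_comul_nil : Dx ^+ q = 0.
Proof.
have pX (a b : P) m : pureT a b ^+ m = pureT (a ^+ m) (b ^+ m) :> tens P P.
  by elim: m => [|m IH]; rewrite ?expr0 // !exprS IH pureTM.
have [pl pr] := @pureT_bilin k P P.
have p0l b : pureT 0 b = 0 :> tens P P.
  by have := (linearDZ (pl b)).2 0 0; rewrite !scale0r.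
have p0r b : pureT b 0 = 0 :> tens P P.
  by have := (linearDZ (pr b)).2 0 0; rewrite !scale0r.
rewrite /Dx exprD_pchar_comm ?pX ?truncX_nil // ?expr1n ?p0l ?p0r ?addr0 //.
by rewrite /GRing.comm !pureTM !mulr1 !mul1r.
Qed.
Fact Ga_antipode_nil : (- x) ^+ q = 0.
Proof. by rewrite exprNn truncX_nil // mulr0. Qed.
Fact Ga_counit_nil : (0 : k^o) ^+ q = 0.
Proof. by rewrite expr0n gtn_eqF. Qed.

Let D := truncEvalMorph q_gt0 Ga_comul_nil.
Let e := truncEvalMorph q_gt0 Ga_counit_nil.
Let S := truncEvalMorph q_gt0 Ga_antipode_nil.

Let DX : D x = Dx. Proof. by rewrite /= (truncEvalX q_gt0 Ga_comul_nil). Qed.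
Let eX : e x = 0. Proof. by rewrite /= (truncEvalX q_gt0 Ga_counit_nil). Qed.
Let SX : S x = - x. Proof. by rewrite /= (truncEvalX q_gt0 Ga_antipode_nil). Qed.

Lemma liftT_D_ext (A : falgType k) (F : P -> P -> A) (G : P -> A) :
  bilin F -> (forall a a' b b', F (a * a') (b * b') = F a b * F a' b') -> F 1 1 = 1 ->
  linear G -> {morph G : u v / u * v} -> G 1 = 1 ->
  F x 1 + F 1 x = G x -> forall f, liftT F (D f) = G f.
Proof.
move=> bF mF F1 lG mG G1 FG; apply: (truncPoly_ext q_gt0) => //.
- by move=> a u v; rewrite !linearP.
- by move=> u v; rewrite rmorphM liftT_multiplicative.
- by rewrite rmorph1 -pureT1 liftT_pure.
- by rewrite DX linearD /= !liftT_pure.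
Qed.

Fact Ga_comulA f :
  liftT (fun a b => liftT (fun a1 a2 => pureT (pureT a1 a2) b) (D a)) (D f) =
  liftT (fun a b => liftT (fun b1 b2 => pureT (pureT a b1) b2) (D b)) (D f).
Proof.
pose T := tens (tens P P) P.
have [pl pr] := @pureT_bilin k P P.
have [ql qr] := @pureT_bilin k (tens P P) P.
pose L a t : T := liftT (fun b1 b2 : P => pureT (pureT a b1) b2) t.
have bL (a : P) : bilin (fun b1 b2 : P => pureT (pureT a b1) b2).
  by split=> w c u v; [rewrite pr ql | rewrite qr].
have L1 t : linear (L ^~ t).
  move=> c u v; rewrite /L -liftT_lincomb; apply: eq_liftT => y z.
  by rewrite pl ql.
have L2 a : linear (L a) by exact: linearP.
have LM a a' t t' : L (a * a') (t * t') = L a t * L a' t'.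
  move: t; apply: tens_ext => [c y z|c y z|b d].
  - by rewrite mulrDl -scalerAl L2.
  - by rewrite L2 mulrDl -scalerAl.
  move: t'; apply: tens_ext => [c y z|c y z|b' d'].
  - by rewrite mulrDr -scalerAr L2.
  - by rewrite L2 mulrDr -scalerAr.
  by rewrite /L pureTM !liftT_pure // !pureTM.
have EL (a b : P) : liftT (fun a1 a2 : P => pureT (pureT a1 a2) b) (D a) = pureT (D a) b.
  pose m : {linear _ -> _} := HB.pack ((@pureT k (tens P P) P)^~ b) (GRing.isLinear.Build k _ _ _ _ (ql b)).
  rewrite -[RHS]/(m _) -[in RHS](liftT_id (D a)).
  by rewrite (linear_liftT _ m).
have L11 : L 1 1 = 1 by rewrite /L -pureT1 liftT_pure.
under eq_liftT => a b do rewrite EL.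
pose G g : T := liftT (fun a b : P => L a (D b)) (D g).
have bG : bilin (fun a b : P => L a (D b)).
  by split=> w c u v; [rewrite L1 | rewrite linearP L2].
have mG a a' b b' : L (a * a') (D (b * b')) = L a (D b) * L a' (D b').
  by rewrite rmorphM LM.
rewrite -[RHS]/(G f); apply: liftT_D_ext.
- by split=> w c u v; [rewrite linearP ql | rewrite qr].
- by move=> a a' b b'; rewrite rmorphM pureTM.
- by rewrite rmorph1 pureT1.
- by move=> c u v; rewrite /G !linearP.
- by move=> u v; rewrite /G rmorphM liftT_multiplicative.
- by rewrite /G rmorph1 -pureT1 liftT_pure // rmorph1.
rewrite /G DX linearD /= !liftT_pure // -[truncEval Dx 1]/(D 1) -[truncEval Dx x]/(D x).
rewrite (rmorph1 D) DX (linearDZ (L2 1)).1 (linearDZ (ql 1)).1 /L -pureT1.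
by rewrite !liftT_pure // addrA.
Qed.

Let eA_lin : linear (fun f : P => (e f : k)%:A : P).
Proof. by move=> a u v; rewrite linearP /= scalerDl scalerA. Qed.
Let eA_mul : {morph (fun f : P => (e f : k)%:A : P) : u v / u * v}.
Proof. by move=> u v; rewrite rmorphM /= -scalerAl mul1r scalerA. Qed.

Fact Ga_counit_l f : liftT (fun a b => (e a : k) *: b) (D f) = f.
Proof.
apply: liftT_D_ext => //.
- split=> w c u v; first by rewrite linearP /= scalerDl scalerA.
  by rewrite scalerDr !scalerA mulrC.
- by move=> a a' b b'; rewrite rmorphM -scalerAl -scalerAr scalerA.
- by rewrite rmorph1 scale1r.
- by rewrite eX rmorph1 scale0r scale1r add0r.
Qed.
Fact Ga_counit_r f : liftT (fun a b => (e b : k) *: a) (D f) = f.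
Proof.
apply: liftT_D_ext => //.
- split=> w c u v; last by rewrite linearP /= scalerDl scalerA.
  by rewrite scalerDr !scalerA mulrC.
- by move=> a a' b b'; rewrite rmorphM -scalerAl -scalerAr scalerA.
- by rewrite rmorph1 scale1r.
- by rewrite eX rmorph1 scale0r scale1r addr0.
Qed.
Fact Ga_antipode_l f : liftT (fun a b => S a * b) (D f) = (e f : k)%:A.
Proof.
apply: (@liftT_D_ext _ _ (fun f => (e f : k)%:A)) => //.
- split=> w c u v; first by rewrite linearP mulrDl -scalerAl.
  by rewrite mulrDr -scalerAr.
- by move=> a a' b b'; rewrite rmorphM mulrACA.
- by rewrite rmorph1 mulr1.
- by rewrite rmorph1 scale1r.
- by rewrite eX SX rmorph1 scale0r mulr1 mul1r addNr.
Qed.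
Fact Ga_antipode_r f : liftT (fun a b => a * S b) (D f) = (e f : k)%:A.
Proof.
apply: (@liftT_D_ext _ _ (fun f => (e f : k)%:A)) => //.
- split=> w c u v; first by rewrite mulrDl -scalerAl.
  by rewrite linearP mulrDr -scalerAr.
- by move=> a a' b b'; rewrite rmorphM mulrACA.
- by rewrite rmorph1 mulr1.
- by rewrite rmorph1 scale1r.
- by rewrite eX SX rmorph1 scale0r mulr1 mul1r addrN.
Qed.

Definition Ga_kernel : finGroupScheme k :=
  @FinGroupScheme k P D e S (@mulrC P) Ga_comulA Ga_counit_l Ga_counit_r
    Ga_antipode_l Ga_antipode_r.
End FrobeniusKernel.

(* The constant group scheme of gT: its coordinate ring is the algebra of
   functions on gT, with comultiplication f |-> ((x, y) |-> f (x * y)). *)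
Definition funAlg (k : fieldType) (gT : finGroupType) : Type := {ffun gT -> k^o}.
HB.instance Definition _ (k : fieldType) (gT : finGroupType) :=
  Vector.copy (funAlg k gT) {ffun gT -> k^o}.

Section FunAlg.
Variables (k : fieldType) (gT : finGroupType).
Local Notation A := (funAlg k gT).
Definition mulF (f g : A) : A := [ffun x => (f : {ffun _ -> _}) x * (g : {ffun _ -> _}) x].
Definition oneF : A := [ffun => 1].
Fact mulFA : associative mulF.
Proof. by move=> f g h; apply/ffunP=> x; rewrite !ffunE mulrA. Qed.
Fact mulFC : commutative mulF.
Proof. by move=> f g; apply/ffunP=> x; rewrite !ffunE [LHS]mulrC. Qed.
Fact mul1F : left_id oneF mulF.
Proof. by move=> f; apply/ffunP=> x; rewrite !ffunE mul1r. Qed.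
Fact mulFDl : left_distributive mulF +%R.
Proof. by move=> f g h; apply/ffunP=> x; rewrite !ffunE mulrDl. Qed.
Fact oneF_neq0 : oneF != 0.
Proof. by apply/eqP=> /ffunP/(_ 1%g)/eqP; rewrite !ffunE oner_eq0. Qed.
HB.instance Definition _ := GRing.Zmodule_isComNzRing.Build A
  mulFA mulFC mul1F mulFDl oneF_neq0.
Fact scaleFAl (a : k) (f g : A) : a *: (f * g) = (a *: f) * g.
Proof. by apply/ffunP=> x; rewrite !ffunE scalerAl. Qed.
HB.instance Definition _ := GRing.Lmodule_isLalgebra.Build k A scaleFAl.
Fact scaleFAr (a : k) (f g : A) : a *: (f * g) = f * (a *: g).
Proof. by rewrite mulrC scaleFAl mulrC. Qed.
HB.instance Definition _ := GRing.Lalgebra_isAlgebra.Build k A scaleFAr.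
HB.instance Definition _ := Algebra_isFalgebra.Build k A.

Definition fval (f : A) (x : gT) : k := (f : {ffun _ -> _}) x.
Definition delta (x : gT) : A := [ffun y => (y == x)%:R].

Lemma fvalM f g x : fval (f * g) x = fval f x * fval g x.
Proof. by rewrite /fval ffunE. Qed.
Lemma fvalP c f g x : fval (c *: f + g) x = c * fval f x + fval g x.
Proof. by rewrite /fval !ffunE. Qed.
Lemma funAlgE (f : A) : f = \sum_x fval f x *: delta x.
Proof.
apply/ffunP=> y; rewrite sum_ffunE (bigD1 y) //= !ffunE eqxx [_ *: _]mulr1 big1 ?addr0 //.
by move=> x ne; rewrite !ffunE eq_sym (negPf ne) scaler0.
Qed.
Lemma fval_ext (f g : A) : fval f =1 fval g -> f = g.
Proof. by move=> h; apply/ffunP=> x; apply: h. Qed.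
Lemma deltaM x y : delta x * delta y = (x == y)%:R *: delta x.
Proof.
apply/ffunP=> z; rewrite !ffunE; case: (z =P x) => [->|]; last by rewrite mul0r scaler0.
by rewrite mul1r [RHS]mulr1.
Qed.
Lemma sum_delta : \sum_x delta x = 1.
Proof. by rewrite [RHS]funAlgE; apply: eq_bigr => x _; rewrite /fval ffunE scale1r. Qed.
Lemma fval_delta x y : fval (delta x) y = (y == x)%:R.
Proof. by rewrite /fval ffunE. Qed.

Definition constD (f : A) : tens A A :=
  \sum_x \sum_y fval f (x * y)%g *: pureT (delta x) (delta y).
Definition constE (f : A) : k^o := fval f 1%g.
Definition constS (f : A) : A := [ffun x => fval f x^-1%g].

Fact constD_linear : linear constD.
Proof.
move=> c f g; rewrite /constD scaler_sumr -big_split; apply: eq_bigr => x _ /=.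
rewrite scaler_sumr -big_split; apply: eq_bigr => y _ /=.
by rewrite fvalP scalerDl scalerA.
Qed.
Lemma liftT_constD (W : vectType k) (B : A -> A -> W) f : bilin B ->
  liftT B (constD f) = \sum_x \sum_y fval f (x * y)%g *: B (delta x) (delta y).
Proof.
move=> bB; rewrite linear_sum; apply: eq_bigr => x _; rewrite linear_sum.
by apply: eq_bigr => y _; rewrite linearZ /= liftT_pure.
Qed.
Fact constD_monoid : monoid_morphism constD.
Proof.
have [pl pr] := @pureT_bilin k A A.
split.
  pose Pl z : {linear _ -> _} := HB.pack ((@pureT k A A)^~ z) (GRing.isLinear.Build k _ _ _ _ (pl z)).
  pose Pr z : {linear _ -> _} := HB.pack (@pureT k A A z) (GRing.isLinear.Build k _ _ _ _ (pr z)).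
  rewrite -pureT1 -[RHS]/(Pl 1 1) -[X in Pl _ X]sum_delta linear_sum; apply: eq_bigr => x _ /=.
  rewrite -[RHS]/(Pr (delta x) 1) -[X in Pr _ X]sum_delta linear_sum; apply: eq_bigr => y _ /=.
  by rewrite /fval ffunE scale1r.
move=> f g; rewrite /constD [RHS]big_distrl /=; apply: eq_bigr => x _.
rewrite [RHS]big_distrl /=; apply: eq_bigr => y _.
rewrite big_distrr (bigD1 x) //= big_distrr (bigD1 y) //=.
have E x' y' : pureT (delta x) (delta y) * pureT (delta x') (delta y') =
   ((x == x')%:R * (y == y')%:R) *: pureT (delta x) (delta y) :> tens A A.
  by rewrite pureTM !deltaM (linearDZ (pl _)).2 (linearDZ (pr _)).2 scalerA.
rewrite -scalerAl -scalerAr E !eqxx mulr1 scale1r scalerA -fvalM.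
rewrite big1 ?addr0; last first.
  by move=> y' ne; rewrite -scalerAl -scalerAr E [y == _]eq_sym (negPf ne) mulr0 scale0r !scaler0.
rewrite big1 ?addr0 // => x' ne; rewrite big_distrr big1 // => y' _ /=.
by rewrite -scalerAl -scalerAr E [x == _]eq_sym (negPf ne) mul0r scale0r !scaler0.
Qed.
Fact constE_linear : linear constE.
Proof. by move=> c f g; rewrite /constE fvalP. Qed.
Fact constE_monoid : monoid_morphism constE.
Proof. by split=> [|f g]; rewrite /constE ?fvalM // /fval ffunE. Qed.
Fact constS_linear : linear constS.
Proof. by move=> c f g; apply/ffunP => x; rewrite !ffunE fvalP. Qed.

HB.instance Definition _ := GRing.isLinear.Build k A (tens A A) _ constD constD_linear.
HB.instance Definition _ := GRing.isMonoidMorphism.Build A (tens A A) constD constD_monoid.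
HB.instance Definition _ := GRing.isLinear.Build k A k^o _ constE constE_linear.
HB.instance Definition _ := GRing.isMonoidMorphism.Build A k^o constE constE_monoid.
HB.instance Definition _ := GRing.isLinear.Build k A A _ constS constS_linear.

Lemma constD_delta (W : vectType k) (B : A -> A -> W) z : bilin B ->
  liftT B (constD (delta z)) = \sum_x B (delta x) (delta (x^-1 * z)%g).
Proof.
move=> bB; rewrite liftT_constD //; apply: eq_bigr => x _.
rewrite (bigD1 (x^-1 * z)%g) //= fval_delta mulKVg eqxx scale1r big1 ?addr0 // => y ne.
rewrite fval_delta -(inj_eq (mulgI x^-1)%g) mulKg (negPf ne) scale0r //.
Qed.

Fact constD_assoc f :
  liftT (fun a b => liftT (fun a1 a2 => pureT (pureT a1 a2) b) (constD a)) (constD f) =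
  liftT (fun a b => liftT (fun b1 b2 => pureT (pureT a b1) b2) (constD b)) (constD f).
Proof.
have [pl pr] := @pureT_bilin k A A.
have [ql qr] := @pureT_bilin k (tens A A) A.
have b1 (b : A) : bilin (fun a1 a2 : A => pureT (pureT a1 a2) b).
  by split=> w c u v; rewrite ?pl ?pr ql.
have b2 (a : A) : bilin (fun b1 b2 : A => pureT (pureT a b1) b2).
  by split=> w c u v; rewrite ?pr ?ql ?qr.
rewrite !liftT_constD; first last.
- split=> w c u v; first by rewrite !linearP.
  by rewrite -liftT_lincomb; apply: eq_liftT => *; rewrite qr.
- split=> w c u v; last by rewrite !linearP.
  by rewrite -liftT_lincomb; apply: eq_liftT => *; rewrite pl ql.
transitivity (\sum_x \sum_y \sum_z fval f (x * y * z)%g *: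
   (pureT (pureT (delta x) (delta y)) (delta z) : tens (tens A A) A)).
  under eq_bigr => x _ do under eq_bigr => y _ do rewrite constD_delta // scaler_sumr.
  under eq_bigr => x _ do rewrite exchange_big.
  rewrite exchange_big; apply: eq_bigr => x _ /=.
  rewrite (reindex_inj (mulgI x)) /=; apply: eq_bigr => y _; apply: eq_bigr => z _.
  by rewrite mulKg.
under [RHS]eq_bigr => x _ do under eq_bigr => y _ do rewrite constD_delta // scaler_sumr.
apply: eq_bigr => x _; rewrite [RHS]exchange_big; apply: eq_bigr => y _ /=.
rewrite [RHS](reindex_inj (mulgI y)) /=; apply: eq_bigr => z _.
by rewrite mulKg mulgA.
Qed.
Fact constD_counit_l f : liftT (fun a b => (constE a : k) *: b) (constD f) = f.
Proof.
rewrite liftT_constD; last first.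
  split=> w c u v; first by rewrite linearP /= scalerDl scalerA.
  by rewrite scalerDr !scalerA mulrC.
rewrite (bigD1 1%g) //= addrC big1 => [|x ne].
  rewrite add0r [RHS]funAlgE; apply: eq_bigr => y _.
  by rewrite /constE fval_delta eqxx scale1r mul1g.
by rewrite big1 // => y _; rewrite /constE fval_delta eq_sym (negPf ne) scale0r scaler0.
Qed.
Fact constD_counit_r f : liftT (fun a b => (constE b : k) *: a) (constD f) = f.
Proof.
rewrite liftT_constD; last first.
  split=> w c u v; last by rewrite linearP /= scalerDl scalerA.
  by rewrite scalerDr !scalerA mulrC.
rewrite [RHS]funAlgE; apply: eq_bigr => x _; rewrite (bigD1 1%g) //= big1 => [|y ne].
  by rewrite /constE fval_delta eqxx scale1r mulg1 addr0.
by rewrite /constE fval_delta eq_sym (negPf ne) scale0r scaler0.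
Qed.
Lemma constS_delta x : constS (delta x) = delta x^-1%g.
Proof. by apply: fval_ext => y; rewrite fval_delta /fval ffunE fval_delta eq_invg_sym. Qed.
Fact constD_antipode_l f : liftT (fun a b => constS a * b) (constD f) = (constE f : k)%:A.
Proof.
rewrite liftT_constD; last first.
  split=> w c u v; first by rewrite linearP mulrDl -scalerAl.
  by rewrite mulrDr -scalerAr.
rewrite -sum_delta scaler_sumr [RHS](reindex_inj invg_inj); apply: eq_bigr => x _ /=.
rewrite (bigD1 x^-1%g) //= big1 => [|y ne].
  by rewrite constS_delta deltaM eqxx scale1r mulgV addr0.
by rewrite constS_delta deltaM eq_sym (negPf ne) scale0r scaler0.
Qed.
Fact constD_antipode_r f : liftT (fun a b => a * constS b) (constD f) = (constE f : k)%:A.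
Proof.
rewrite liftT_constD; last first.
  split=> w c u v; first by rewrite mulrDl -scalerAl.
  by rewrite linearP mulrDr -scalerAr.
rewrite -sum_delta scaler_sumr; apply: eq_bigr => x _ /=.
rewrite (bigD1 x^-1%g) //= big1 => [|y ne].
  by rewrite constS_delta deltaM invgK eqxx scale1r mulgV addr0.
rewrite constS_delta deltaM -(inj_eq invg_inj) invgK eq_sym (negPf ne) scale0r scaler0 //.
Qed.
Definition constGroup : finGroupScheme k :=
  @FinGroupScheme k A constD constE constS (@mulrC A) constD_assoc
    constD_counit_l constD_counit_r constD_antipode_l constD_antipode_r.
End FunAlg.

(* A closed embedding G -> E, given by its comorphism k[E] -> k[G].  Subgroups
   of E isomorphic to G are the images of such embeddings. *)
Record closedEmbedding (k : fieldType) (G E : finGroupScheme k) := ClosedEmbedding {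
  comorphism : {lrmorphism coordRing E -> coordRing G};
  comorphism_comul : forall f, comul G (comorphism f) =
    liftT (fun a b => pureT (comorphism a) (comorphism b)) (comul E f);
  comorphism_surj : forall g, exists f, comorphism f = g
}.

Section Pushforward.
Variables (k : fieldType) (G E : finGroupScheme k) (i : closedEmbedding G E).

Definition pushforward (u : measures G) : measures E :=
  (u \o linfun (comorphism i))%VF.
Fact pushforward_linear : linear pushforward.
Proof. by move=> a u v; rewrite /pushforward comp_lfunDl comp_lfunZl. Qed.
HB.instance Definition _ := GRing.isLinear.Build k (measures G) (measures E) _
  pushforward pushforward_linear.

Definition submeasures : {vspace measures E} := limg (linfun pushforward).
End Pushforward.

(* GaFactor r stands for the (r+1)-st Frobenius kernel. *)
Inductive elemFactor := GaFactor of nat | ZpFactor.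

Definition elemScheme (k : fieldType) p (charp : p \in [pchar k]) (c : elemFactor) :
    finGroupScheme k :=
  match c with
  | GaFactor r => Ga_kernel charp r.+1
  | ZpFactor => constGroup k 'Z_p
  end.

(* E = E_1 ... E_n means that multiplication E_1 x ... x E_n -> E is a quotient
   map, i.e. that kE is spanned by the products of elements of the kE_i. *)
Definition elementary_abelian (k : fieldType) p (charp : p \in [pchar k])
    (E : finGroupScheme k) : Prop :=
  (forall u v : measures E, u * v = v * u) /\
  exists (n : nat) (c : 'I_n -> elemFactor)
         (i : forall t, closedEmbedding (elemScheme charp (c t)) E),
    \big[@prodv k (measures E)/1%VS]_(t < n) submeasures (i t) = fullv.

Section Radical.
Variables (k : fieldType) (A : falgType k).

Definition left_ideal (I : {vspace A}) := (fullv * I <= I)%VS.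

Definition maximal_left_ideal (I : {vspace A}) : Prop :=
  [/\ left_ideal I, I != fullv
    & forall J : {vspace A}, left_ideal J -> (I <= J)%VS -> J = I \/ J = fullv].

Lemma Rad_exists : exists R : {vspace A},
  forall x, x \in R <-> forall I, maximal_left_ideal I -> x \in I.
Proof.
suff H n (R : {vspace A}) : (\dim R <= n)%N ->
    (forall x, (forall I, maximal_left_ideal I -> x \in I) -> x \in R) ->
    exists R : {vspace A}, forall x,
      x \in R <-> forall I, maximal_left_ideal I -> x \in I.
  by apply: (H (\dim {:A}) fullv) => // x _; rewrite memvf.
elim: n R => [|n IH] R dR sR.
  exists R => x; split=> [xR I _|]; last exact: sR.
  have : (R <= 0)%VS by rewrite subv0 -dimv_eq0 -leqn0.
  by move/subvP/(_ _ xR); rewrite memv0 => /eqP->; rewrite mem0v.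
case: (classic (exists2 I, maximal_left_ideal I & ~~ (R <= I)%VS)) => [[I mI nRI]|h].
  apply: (IH (R :&: I)%VS) => [|x hx]; last by rewrite memv_cap sR // hx.
  rewrite -ltnS; apply: leq_trans dR; rewrite ltn_neqAle dimvS ?capvSl // andbT.
  by apply: contra nRI => /eqP e; apply/capv_idPl/eqP; rewrite eqEdim capvSl e /=.
exists R => x; split=> [xR I mI|]; last exact: sR.
have : (R <= I)%VS by apply/negPn/negP => nRI; apply: h; exists I.
by move/subvP; apply.
Qed.

Definition Rad : {vspace A} :=
  proj1_sig (constructive_indefinite_description _ Rad_exists).

Lemma RadP x : x \in Rad <-> forall I, maximal_left_ideal I -> x \in I.
Proof. exact: (proj2_sig (constructive_indefinite_description _ Rad_exists)). Qed.
End Radical.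
Arguments Rad {k} A.

Definition projective (R : nzRingType) (P : lmodType R) : Prop :=
  forall (N N' : lmodType R) (g : {linear N -> N'}) (f : {linear P -> N'}),
    (forall y, exists x, g x = y) ->
    exists h : {linear P -> N}, forall x, g (h x) = f x.

(* A as an R-module by restriction along alpha *)
Definition restrict (R A : nzRingType) (alpha : {rmorphism R -> A}) : Type := A.
HB.instance Definition _ (R A : nzRingType) (alpha : {rmorphism R -> A}) :=
  GRing.Zmodule.copy (restrict alpha) A.

Section Restrict.
Variables (R A : nzRingType) (alpha : {rmorphism R -> A}).
Definition restrict_scale (a : R) (x : restrict alpha) : restrict alpha :=
  alpha a * (x : A).
Fact restrict_scaleA a b x :
  restrict_scale a (restrict_scale b x) = restrict_scale (a * b) x.
Proof. by rewrite /restrict_scale rmorphM mulrA. Qed.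
Fact restrict_scale1 : left_id 1 restrict_scale.
Proof. by move=> x; rewrite /restrict_scale rmorph1 mul1r. Qed.
Fact restrict_scaleDr : right_distributive restrict_scale +%R.
Proof. by move=> a x y; rewrite /restrict_scale -[x + y]/((x : A) + (y : A)) mulrDr. Qed.
Fact restrict_scaleDl x : {morph restrict_scale^~ x : a b / a + b}.
Proof. by move=> a b; rewrite /restrict_scale rmorphD mulrDl. Qed.
HB.instance Definition _ := GRing.Zmodule_isLmodule.Build R (restrict alpha)
  restrict_scaleA restrict_scale1 restrict_scaleDr restrict_scaleDl.
End Restrict.

Record ppoint (k : fieldType) (p : nat) (E : finGroupScheme k) := PPoint {
  ppoint_map : {lrmorphism truncPoly k p -> measures E};
  ppoint_projective : projective (restrict ppoint_map)
}.

Definition ppoint_t (k : fieldType) p (E : finGroupScheme k) (alpha : ppoint p E) :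
  measures E := ppoint_map alpha (truncX k p).

Section JRank.
Variables (k : fieldType) (E : finGroupScheme k).
Implicit Type M : emodule E.

Definition op_pow M (j : nat) (u : measures E) : 'End(M) :=
  iter j (fun g => (mact M u \o g)%VF) \1%VF.

Definition lfun_rank M (f : 'End(M)) : nat := \dim (limg f).

Definition jrank (p : nat) M (j : nat) : nat :=
  \max_(d < (\dim {:M}).+1
        | is_left (excluded_middle_informative
            (exists alpha : ppoint p E, lfun_rank (op_pow M j (ppoint_t alpha)) = d)))
    d.

Definition constant_jrank (p : nat) M (j : nat) : Prop :=
  forall alpha : ppoint p E, lfun_rank (op_pow M j (ppoint_t alpha)) = jrank p M j.
End JRank.

(* Points of P(V) are represented by non-zero vectors of V, up to scaling. *)
Section Degree.
Variables (k : fieldType) (V W : vectType k).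

Definition same_point (v w : W) : Prop :=
  [/\ v != 0, w != 0 & exists c : k, v = c *: w].

Definition gcd_is_one m n (f : 'I_m -> {mpoly k[n]}) : Prop :=
  forall g : {mpoly k[n]}, (forall i, exists h, f i = h * g) ->
  exists2 c : k, c != 0 & g = c%:MP.

Definition has_degree (U : V -> Prop) (phi : V -> W) (d : nat) : Prop :=
  exists f : 'I_(\dim {:W}) -> {mpoly k[\dim {:V}]},
  [/\ forall i, f i \is d.-homog, gcd_is_one f
    & forall x : V, x != 0 -> U x ->
        same_point
          (\sum_i (f i).@[fun l => coord (vbasis {:V}) l x] *: (vbasis {:W})`_i)
          (phi x)].

Definition degree (U : V -> Prop) (phi : V -> W) : nat :=
  epsilon (inhabits 0%N) (has_degree U phi).
End Degree.

(* The d-th exterior power of W, in coordinates: the basis vector indexed by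
   i_1 < ... < i_d is e_{i_1} /\ ... /\ e_{i_d} for (e_i) = vbasis {:W}. *)
Definition increasing (d n : nat) : finType :=
  {I : {ffun 'I_d -> 'I_n} |
    [forall a : 'I_d, forall b : 'I_d, (a < b)%N ==> (I a < I b)%N]}.

Definition extPower (k : fieldType) (d : nat) (W : vectType k) : vectType k :=
  {ffun increasing d (\dim {:W}) -> k^o}.

Definition wedge (k : fieldType) (d : nat) (W : vectType k) (w : 'I_d -> W) :
  extPower d W :=
  [ffun I : increasing d (\dim {:W}) =>
     \det (\matrix_(a, b) coord (vbasis {:W}) (val I b) (w a)) : k^o].

Definition plucker (k : fieldType) (d : nat) (W : vectType k) (X : {vspace W}) :
  extPower d W := wedge (fun a : 'I_d => (vbasis X)`_a).

Section JDegree.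
Variables (k : fieldType) (E : finGroupScheme k).
Local Notation R := (Rad (measures E)).

Definition UE (x : subvs_of R) : Prop := vsval x \notin (R * R)%VS.

Definition ImM (M : emodule E) (j : nat) (x : subvs_of R) : {vspace M} :=
  limg (op_pow M j (vsval x)).

Definition jdegree (p : nat) (M : emodule E) (j : nat) : nat :=
  let d := jrank p M j in
  if d == 0%N then 0%N else degree UE (fun x => plucker d (ImM M j x)).

(* The number s of variables in kE = k[X_1, ..., X_s]/(X_1^p, ..., X_s^p). *)
Definition nb_generators : nat := (\dim R - \dim (R * R)%VS)%N.
End JDegree.
Arguments nb_generators {k} E.

(* Main.v *)
Require Import Defs.
From HB Require Import structures.
From mathcomp Require Import ssreflect ssrfun ssrbool eqtype ssrnat seq choice.
From mathcomp Require Import fintype finfun tuple bigop div prime binomial.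
From mathcomp Require Import finset fingroup perm ssralg zmodp poly polydiv qpoly matrix.
From mathcomp Require Import mxalgebra vector falgebra cyclic mpoly zify ring.
From Stdlib Require Import ClassicalEpsilon.

(* Let u be a generic element of Rad(kE).  The d x d minors of the matrix of u^j,
   where d = rk^j(M), are homogeneous of degree j d and form a matrix of rank
   one; by unique factorisation in k[X_1, ..., X_n] it equals g a b^T with
   primitive vectors a and b.  The vector a gives the Pluecker coordinates of the
   image on M, and b those of the image on the dual, up to the linear
   substitution by the antipode; so the degrees of a, b and g add up to j d.
   Since u^j has rank d off Rad^2, g has no zero there, and as Rad^2 has
   codimension at least 2 in Rad, g is constant.

   That every u in Rad \ Rad^2 comes from a p-point is seen as follows.  All
   elements of the augmentation ideal have p-th power 0.  A primitive element h
   of k[E] with u(h) = 1 yields a derivation of kE mapping u to a unit, and this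
   forces the kernel of u to be u^(p-1) kE, whence kE is free over k[u]. *)

Set Implicit Arguments.
Unset Strict Implicit.
Unset Printing Implicit Defensive.

Import GRing.Theory.
Local Open Scope ring_scope.

(** * Unique factorisation *)

(** Degrees are read off after common factors have been removed, and the minors giving the Pluecker
    coordinates of a generic image do have common factors. A single column of minors has degree
    [j * d] but does not tell how much of it cancels. The full matrix of minors does: up to [g], the
    factor that cancels in the column with index [J] is the [J]-th Pluecker coordinate for the dual.
    So what is lost in the degree for [M] is exactly what is gained in the degree for the dual.
    Since [u] acts on the dual by the transpose of the antipode of [u], the matrix that is studied
    belongs to the antipode of [u]; the degree for [M] itself is recovered through the automorphism
    which the antipode induces on the radical. As [degree] selects a number by [epsilon], the
    existence of primitive homogeneous coordinates must be proved too; it rests on the same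
    factorisation, together with the fact that factors of a homogeneous polynomial are
    homogeneous. *)

Section Factorial.
Variable S : idomainType.
Implicit Types a b c d : S.

Definition divides a b := exists c, b = c * a.

Definition prime_elt a :=
  [/\ a != 0, a \isn't a GRing.unit
    & forall b c, divides a (b * c) -> divides a b \/ divides a c].

Definition irreducible_elt a :=
  [/\ a != 0, a \isn't a GRing.unit
    & forall b c, a = b * c -> b \is a GRing.unit \/ c \is a GRing.unit].

(** Factorisation into prime, not merely irreducible, elements: the divisibility arguments below go
    by induction on this predicate and peel off one prime at a time. *)
Inductive factored : S -> Prop :=
| factored_unit u : u \is a GRing.unit -> factored u
| factored_prime q a : prime_elt q -> factored a -> factored (q * a).

Definition factorial_ring := forall a, a != 0 -> factored a.

Lemma divides_unit u a : u \is a GRing.unit -> divides u a.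
Proof. by move=> uu; exists (a / u); rewrite divrK. Qed.

Lemma divides_mull a b c : divides a c -> divides a (b * c).
Proof. by case=> d ->; exists (b * d); rewrite mulrA. Qed.

Lemma divides_trans a b c : divides a b -> divides b c -> divides a c.
Proof. by move=> [d ->] [e ->]; exists (e * d); rewrite mulrA. Qed.

Lemma divides_pmul2l a b c : a != 0 -> divides (a * b) (a * c) -> divides b c.
Proof.
move=> a0 [d e]; exists d; apply: (mulfI a0); rewrite e.
by rewrite mulrCA.
Qed.

Lemma factoredM a b : factored a -> factored b -> factored (a * b).
Proof.
elim=> [u uu|q c pq _ IH] fb; last by rewrite -mulrA; apply: factored_prime => //; apply: IH.
elim: fb => [v uv|q c pq _ IH]; first by apply: factored_unit; rewrite unitrM uu uv.
by rewrite mulrCA; apply: factored_prime.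
Qed.

End Factorial.

Section GaussLemma.
Variable S : idomainType.
Hypothesis fS : factorial_ring S.
Implicit Types (a b c q : S) (f g h d r : {poly S}).

Lemma dividesCP q f : divides q%:P f <-> forall i, divides q f`_i.
Proof.
split=> [[g ->] i|h]; first by exists g`_i; rewrite coefMC.
have [e eE] := choice _ (h : forall i, exists c, f`_i = c * q).
exists (\poly_(i < size f) e i); apply/polyP => i; rewrite coefMC coef_poly.
by case: ltnP => [_|/leq_sizeP->]; rewrite ?eE ?mul0r.
Qed.

(* S/(q) is a domain: compare the first coefficients not divisible by q. *)
Lemma prime_polyC q : prime_elt q -> prime_elt q%:P.
Proof.
move=> [q0 nuq qP]; split; rewrite ?polyC_eq0 //.
  by apply: contra nuq; rewrite poly_unitE size_polyC coefC eqxx q0.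
move=> f g qfg; case: (classic (divides q%:P f)) => [|nf]; [by left|right].
apply: NNPP => ng.
have first_bad (h : {poly S}) : ~ divides q%:P h ->
    exists m, ~ divides q h`_m /\ forall i, (i < m)%N -> divides q h`_i.
  move=> nh; have [i] : exists i, ~ divides q h`_i.
    by apply: NNPP => H; apply: nh; apply/dividesCP => i; apply: NNPP => Hi; apply: H; exists i.
  elim/ltn_ind: i => i IH hi.
  case: (classic (exists2 l, (l < i)%N & ~ divides q h`_l)) => [[l li hl]|H].
    exact: (IH l).
  exists i; split=> // l li; apply: NNPP => hl; apply: H; by exists l.
have [m [fm fl]] := first_bad _ nf; have [n [gn gl]] := first_bad _ ng.
have : divides q (f`_m * g`_n).
  have /dividesCP/(_ (m + n)%N) := qfg; rewrite coefM.
  have mlt : (m < (m + n).+1)%N by rewrite ltnS leq_addr.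
  rewrite (bigD1 (Ordinal mlt)) //= addKn => -[c e].
  have : divides q (\sum_(i < (m + n).+1 | i != Ordinal mlt) f`_i * g`_(m + n - i)).
    elim/big_ind: _ => [|x y [u ->] [v ->]|i ne]; first by exists 0; rewrite mul0r.
      by exists (u + v); rewrite mulrDl.
    case: (ltngtP i m) => [im|mi|im].
    - by rewrite mulrC; apply/divides_mull/fl.
    - apply/divides_mull/gl; rewrite ltn_subLR ?ltn_add2r //; last by rewrite -ltnS.
    - by case/eqP: ne; apply: val_inj.
  case=> v ev; exists (c - v); rewrite mulrBl -e ev addrK //.
by case/qP.
Qed.

(** Each prime factor of [c] remains prime among polynomials, so it divides [d] or [r] and can be
    cancelled there. Sizes do not change, as only constants are removed. *)
Lemma Gauss_factor c f d r : c != 0 -> c *: f = d * r ->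
  exists d' r', [/\ f = d' * r', size d' = size d & size r' = size r].
Proof.
move=> c0; elim: (fS c0) d r => {c c0} [u uu|q c pq _ IH] d r e.
  exists d, (u^-1 *: r); split=> //; last by rewrite size_scale // invr_eq0 (memPn _ _ uu) // unitr0.
  by rewrite -scalerAr -e scalerA mulVr // scale1r.
have [q0 _ _] := pq; have [_ _ qP] := prime_polyC pq.
have : divides q%:P (d * r) by exists (c *: f); rewrite -e -scalerA mulrC mul_polyC.
case/qP => -[g eg].
- have [|d' [r' [-> sd sr]]] := IH g r.
    apply: (mulfI (_ : q%:P != 0)); first by rewrite polyC_eq0.
    by rewrite mulrA [q%:P * g]mulrC -eg -e -mul_polyC -mul_polyC mulrA -polyCM mul_polyC.
  by exists d', r'; split=> //; rewrite sd eg mulrC mul_polyC size_scale.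
have [|d' [r' [-> sd sr]]] := IH d g.
  apply: (mulfI (_ : q%:P != 0)); first by rewrite polyC_eq0.
  by rewrite mulrCA [q%:P * g]mulrC -eg -e -mul_polyC -mul_polyC mulrA -polyCM mul_polyC.
by exists d', r'; split=> //; rewrite sr eg mulrC mul_polyC size_scale.
Qed.

(** As [f] is primitive, every prime factor of [c] must divide [r]. *)
Lemma Gauss_divides f g c r : c != 0 -> c *: g = r * f ->
  (forall q, prime_elt q -> ~ divides q%:P f) -> divides f g.
Proof.
move=> c0 + nf; elim: (fS c0) r => {c c0} [u uu|q c pq _ IH] r e.
  by exists (u^-1 *: r); rewrite -scalerAl -e scalerA mulVr // scale1r.
have [q0 _ _] := pq; have [_ _ qP] := prime_polyC pq.
have : divides q%:P (r * f) by exists (c *: g); rewrite -e -scalerA mulrC mul_polyC.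
case/qP => [[s es]|/(nf _ pq)//].
apply: (IH s); apply: (mulfI (_ : q%:P != 0)); first by rewrite polyC_eq0.
by rewrite mulrA [q%:P * s]mulrC -es -e -mul_polyC -mul_polyC mulrA -polyCM mul_polyC.
Qed.

Import Pdiv.Idomain.

(** A constant [f] is a prime of [S] times a unit. Otherwise [f] is primitive, and [gcdp f g], which
    is a gcd over the fraction field, yields by [Gauss_factor] a true factorisation of [f]. By
    irreducibility the gcd is either of the size of [f], so that [f] divides [g], or constant, so
    that [f] divides [h]. *)
Lemma irreducible_poly_prime f : irreducible_elt f -> prime_elt f.
Proof.
move=> [f0 nuf fI].
have [sf|sf] := leqP (size f) 1.
  have ef := size1_polyC sf; set a := f`_0 in ef.
  have a0 : a != 0 by rewrite -polyC_eq0 -ef.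
  have nua : a \isn't a GRing.unit.
    by apply: contra nuf; rewrite ef poly_unitE size_polyC coefC eqxx a0.
  case: (fS a0) (ef) nua => [u -> //|q b pq _ efq _].
  have := prime_polyC pq; rewrite efq polyCM.
  have [||ub [q0 nuq qP]] := fI q%:P b%:P; first by rewrite -polyCM.
    by move=> uq; case: (prime_polyC pq) => _; rewrite uq.
  split; rewrite -?polyCM -?efq //.
  move=> g h; rewrite efq polyCM => /(divides_trans (_ : divides q%:P _)) H.
  have ubq (g' : {poly S}) : divides q%:P g' -> divides (q%:P * b%:P) g'.
    by case=> e ->; exists (e / b%:P); rewrite [q%:P * _]mulrC mulrA divrK.
  have : divides q%:P (g * h) by apply: H; exists b%:P; rewrite mulrC.
  by case/qP => /ubq; [left | right].
have nf q : prime_elt q -> ~ divides q%:P f.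
  move=> pq [g e]; have [q0 nuq _] := prime_polyC pq.
  case/fI: (e) => [ug|]; last by apply/negP.
  move: sf; rewrite e; move: ug; rewrite poly_unitE => /andP[/size_poly1P[c c0 ->] _].
  by rewrite -polyCM size_polyC; case: (_ != 0).
(* [%|] only means divisibility after multiplication by a non-zero constant; primitivity of [f]
   removes that constant. *)
have dvd_divides g : f %| g -> divides f g.
  rewrite Pdiv.WeakIdomain.dvdp_eq => /eqP e; apply: Gauss_divides e nf.
  by rewrite expf_neq0 // lead_coef_eq0.
split=> // g h [e eE].
have fgh : f %| g * h by rewrite eE dvdp_mull.
have : gcdp f g %| f by exact: dvdp_gcdl.
have d0 : gcdp f g != 0 by rewrite gcdp_eq0 negb_and f0.
rewrite Pdiv.WeakIdomain.dvdp_eq => /eqP e2; case: (Gauss_factor _ e2).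
  by rewrite expf_neq0 // lead_coef_eq0.
move=> d' [r' [ef sd sr]].
case/fI: (ef) => [ud|ur].
  left; apply: dvd_divides; apply: dvdp_trans (dvdp_gcdr f g).
  have /eqP : size (gcdp f g) == size f.
    move: ud; rewrite poly_unitE => /andP[/size_poly1P[c c0 ed] _].
    by rewrite -sr ef ed mul_polyC size_scale.
  by move=> es; have := dvdp_size_eqp (dvdp_gcdl f g); rewrite es eqxx => /esym/andP[].
right; apply: dvd_divides; rewrite -(@Gauss_dvdpr _ _ g) //.
move: ur; rewrite poly_unitE => /andP[/size_poly1P[c c0 er] _].
by rewrite coprimep_def -sr er size_polyC c0.
Qed.

End GaussLemma.

(** * Polynomials in n + 1 variables as polynomials in the last one *)

Section MuniIso.
Variables (k : idomainType) (n : nat).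
Local Notation S := {mpoly k[n]}.
Local Notation widen := (widen_ord (leqnSn n)).

Definition munmap (q : {poly S}) : {mpoly k[n.+1]} :=
  (map_poly (@mwiden n k) q).['X_ord_max].

HB.instance Definition _ :=
  GRing.RMorphism.copy munmap (horner_eval ('X_(@ord_max n) : {mpoly k[n.+1]}) \o map_poly (@mwiden n k)).

Lemma muniK : cancel (@muni n k) munmap.
Proof.
move=> f; rewrite muniE rmorph_sum /= [RHS]mpolyE; apply: eq_bigr => m _.
rewrite /munmap map_polyZ /= map_polyXn hornerZ hornerXn mwidenZ mwidenX -scalerAl.
congr (_ *: _); rewrite mpolyXn -mpolyXD; congr 'X_[_]; apply/mnmP => i.
rewrite mnmDE mulmnE mnm1E; have [j ->|->] := unliftP ord_max i.
  have -> : lift ord_max j = widen j by apply/val_inj; rewrite /= /bump leqNgt ltn_ord.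
  rewrite mnmwiden_widen mnmE -val_eqE /= gtn_eqF ?ltn_ord //.
  by rewrite mul0n addn0.
by rewrite mnmwiden_ordmax eqxx mul1n.
Qed.

Lemma muni_surj (q : {poly S}) : exists f, muni f = q.
Proof.
exists (munmap q).
have mX : muni ('X_ord_max : {mpoly k[n.+1]}) = 'X.
  rewrite muniE msuppX big_seq1 mcoeffX eqxx scale1r.
  have -> : [multinom U_(@ord_max n)%MM (widen i) | i < n] = 0%MM :> 'X_{1..n}.
    by apply/mnmP => i; rewrite mnmE mnm0E mnm1E -val_eqE /= gtn_eqF ?ltn_ord.
  by rewrite mpolyX0 mnm1E eqxx scale1r.
have mw (c : S) : muni (mwiden c) = c%:P.
  rewrite [c]mpolyE (raddf_sum (@mwiden n k)) (raddf_sum (@muni n k)) raddf_sum /=.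
  apply: eq_bigr => m _; rewrite mwidenZ muniZ mwidenX muniE msuppX big_seq1 mcoeffX eqxx scale1r.
  rewrite mnmwiden_ordmax expr0 alg_polyC -mul_polyC -polyCM mul_mpolyC; congr ((_ *: 'X_[_])%:P).
  by apply/mnmP => i; rewrite mnmE mnmwiden_widen.
rewrite /munmap horner_coef (size_map_inj_poly (@inj_mwiden n k) (mwiden0 _ _)).
rewrite rmorph_sum /= -[RHS]coefK poly_def; apply: eq_bigr => i _.
by rewrite coef_map /= rmorphM rmorphXn /= mX mw mul_polyC.
Qed.

Lemma meval_munmap (w : 'I_n.+1 -> k) q :
  (munmap q).@[w] = (map_poly (meval (w \o widen)) q).[w ord_max].
Proof.
rewrite /munmap -horner_map /= mevalXU -map_poly_comp_id0 ?mwiden0 ?meval0 //.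
congr _.[_]; apply: eq_map_poly => c /=.
rewrite [c]mpolyE (raddf_sum (@mwiden n k)) !(raddf_sum (meval _)) /=.
apply: eq_bigr => m _; rewrite mwidenZ !mevalZ mwidenX !mevalX big_ord_recr /= mnmwiden_ordmax expr0 mulr1.
by congr (_ * _); apply: eq_bigr => i _; rewrite mnmwiden_widen.
Qed.

End MuniIso.

(** Induction on the number of variables, then on the size. A reducible polynomial splits into
    smaller ones; an irreducible one is prime because [muni] carries it to a polynomial in one
    variable over a ring that is factorial by induction. *)
Lemma mpoly_factorial (k : fieldType) n : factorial_ring {mpoly k[n]}.
Proof.
have unitE m (a : {mpoly k[m]}) : a != 0 -> (a \is a GRing.unit) = (msize a == 1%N).
  move=> a0; apply/andP/msize_poly1P => [[/eqP e u]|[c c0 ->]].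
    by exists a@_0; rewrite // -unitfE.
  by rewrite mcoeffC eqxx mulr1 unitfE.
elim: n => [|n IHn] a a0.
  apply: factored_unit; rewrite unitE // [a]nvar0_mpolyC.
  by rewrite msizeC -(mpolyC_eq0 0) -nvar0_mpolyC a0.
elim: {a}(msize a) {-2}a (leqnn (msize a)) a0 => [|N IH] a sa a0.
  by move: sa; rewrite leqn0 msize_poly_eq0 (negPf a0).
case: (boolP (a \is a GRing.unit)) => [ua|nua]; first exact: factored_unit.
case: (classic (irreducible_elt a)) => [[_ _ aI]|nI]; last first.
  have [b [c [e nub nuc]]] : exists b c, [/\ a = b * c, b \isn't a GRing.unit & c \isn't a GRing.unit].
    apply: NNPP => H; apply: nI; split=> // b c e.
    apply: NNPP => H'; apply: H; exists b, c; split=> //; apply/negP => h; apply: H'; auto.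
  have [b0 c0] : b != 0 /\ c != 0 by move: a0; rewrite e mulf_eq0 negb_or => /andP.
  have sb : (1 < msize b)%N.
    by move: nub; rewrite unitE //; move: b0; rewrite -msize_poly_eq0; case: (mmeasure _ _) => [|[]].
  have sc : (1 < msize c)%N.
    by move: nuc; rewrite unitE //; move: c0; rewrite -msize_poly_eq0; case: (mmeasure _ _) => [|[]].
  move: sa; rewrite e msizeM // => sbc; apply: factoredM; apply: IH => //.
    rewrite -ltnS; apply: leq_trans sbc; move: sb sc; case: (msize b) => // x; case: (msize c) => // y.
    by move=> _; rewrite addSn /= addnS !ltnS => y0; rewrite -addn1 leq_add2l.
  rewrite -ltnS; apply: leq_trans sbc; move: sb sc; case: (msize b) => // x; case: (msize c) => // y.
  by rewrite addSn /= addnS !ltnS => x0 _; rewrite -add1n leq_add2r.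
rewrite -[a]mulr1; apply: factored_prime; last by apply: factored_unit; rewrite unitr1.
have muni_unit (f : {mpoly k[n.+1]}) : muni f \is a GRing.unit -> f \is a GRing.unit.
  case/unitrP => g [gf fg]; apply/unitrP; exists (munmap g).
  by rewrite -[f]muniK -!rmorphM /= gf fg rmorph1.
have Im : irreducible_elt (muni a).
  split; first by rewrite -(muni0 n k) (inj_eq (can_inj (@muniK k n))).
    by apply: contra nua => /muni_unit.
  move=> b c; have [b' <-] := muni_surj b; have [c' <-] := muni_surj c.
  rewrite -rmorphM => /(can_inj (@muniK _ _))/aI[u|u]; [left|right]; exact: rmorph_unit.
have [_ _ mP] := irreducible_poly_prime IHn Im.
split=> // b c [d e].
have [|[u]|[u]] := mP (muni b) (muni c).
- by exists (muni d); rewrite -!rmorphM e.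
- by move=> h; left; exists (munmap u); rewrite -[b]muniK h rmorphM /= muniK.
- by move=> h; right; exists (munmap u); rewrite -[c]muniK h rmorphM /= muniK.
Qed.

(** * Primitive vectors of polynomials *)

Section PrimitiveVectors.
Variables (k : fieldType) (n m : nat).
Implicit Types f v : 'I_m -> {mpoly k[n]}.

Lemma prime_mpoly_nconst (q : {mpoly k[n]}) c : prime_elt q -> c != 0 -> q <> c%:MP.
Proof.
move=> [_ /negP nu _] c0 e; apply: nu; rewrite e; apply/unitrP; exists (c^-1)%:MP.
by rewrite -!mpolyCM mulVf // mulfV.
Qed.

(** A prime factor of [h] fails to divide some [f i], hence divides [v]; cancel it and continue. *)
Lemma gcd_is_one_cancel f (h v : {mpoly k[n]}) : h != 0 -> gcd_is_one f ->
  (forall i, divides h (v * f i)) -> divides h v.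
Proof.
move=> h0 gf; elim: (mpoly_factorial h0) v => {h h0} [u uu|q a pq _ IH] v hv.
  exact: divides_unit.
have [q0 _ qP] := pq.
have [i ni] : exists i, ~ divides q (f i).
  apply: NNPP => H; have [i|c c0] := gf q; last exact: prime_mpoly_nconst.
  by apply: NNPP => Hi; apply: H; exists i.
have : divides q (v * f i) by apply: divides_trans (hv i); exists a; rewrite mulrC.
case/qP => // -[w e].
have [|c ec] := IH w.
  move=> l; apply: (divides_pmul2l q0); have := hv l.
  by rewrite e [w * q]mulrC -mulrA.
by exists c; rewrite e ec; ring.
Qed.

Lemma gcd_is_one_nz f : gcd_is_one f -> exists i, f i != 0.
Proof.
move=> gf; apply: NNPP => H; have [i|c c0 e] := gf 0.
  exists 0; rewrite mulr0; apply/eqP/negPn/negP => h; apply: H; by exists i.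
by have := mpolyC_eq0 n c; rewrite -e eqxx (negPf c0).
Qed.

(** For an [i] with [f i] non-zero, [f i] divides all [v i * f j], hence [v i]. The quotient is the
    common multiplier. *)
Lemma gcd_is_one_parallel f v : gcd_is_one f ->
  (forall i j, v i * f j = v j * f i) -> exists c, forall i, v i = c * f i.
Proof.
move=> gf vf; have [i fi0] := gcd_is_one_nz gf.
have [|c e] := @gcd_is_one_cancel f (f i) (v i) fi0 gf.
  by move=> j; exists (v j); rewrite vf.
exists c => j; apply: (mulIf fi0); rewrite -vf e; ring.
Qed.

(** Dividing by a non-constant common factor lowers the size of the non-zero entry [v i0], so this
    stops. *)
Lemma primitive_part v : (exists i, v i != 0) ->
  exists f g, gcd_is_one f /\ forall i, v i = g * f i.
Proof.
case=> i0; move: v; suff H N v : (msize (v i0) <= N)%N -> v i0 != 0 ->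
    exists f g, gcd_is_one f /\ forall i, v i = g * f i.
  by move=> v; apply: (H (msize (v i0))).
elim: N v => [|N IH] v sv v0.
  by move: sv; rewrite leqn0 msize_poly_eq0 (negPf v0).
case: (classic (gcd_is_one v)) => [gv|ng].
  by exists v, 1; split=> // i; rewrite mul1r.
have [g [gv ngc]] : exists g : {mpoly k[n]}, (forall i, exists h, v i = h * g) /\ (msize g != 1%N).
  apply: NNPP => H; apply: ng => g gv; apply/msize_poly1P/negPn/negP => h; apply: H; by exists g.
have [w wE] := choice _ gv.
have [w0 g0] : w i0 != 0 /\ g != 0 by move: v0; rewrite wE mulf_eq0 negb_or => /andP.
have [|//|f [h [gf hE]]] := IH w.
  move: sv; rewrite wE msizeM //; move: ngc g0; rewrite -msize_poly_eq0.
  case: (mmeasure _ g) => [|[|a]] // _ _; rewrite !addnS /= ltnS => h; exact: leq_trans (leq_addr _ _) h.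
by exists f, (h * g); split=> // i; rewrite wE hE mulrAC.
Qed.

End PrimitiveVectors.

(** * Homogeneous polynomials *)

Section Homogeneous.
Variables (k : idomainType) (n : nat).
Local Notation S := {mpoly k[n]}.

(** The substitution of [X_i T] for [X_i], as a polynomial in [T]: the coefficient of [T^e] is the
    homogeneous component of degree [e]. *)
Definition mscale (f : S) : {poly S} :=
  mmap (polyC \o @mpolyC n k) (fun i => ('X_i)%:P * 'X) f.

Lemma mscaleE f : mscale f = \sum_(m <- msupp f) (f@_m *: 'X_[m])%:P * 'X^(mdeg m).
Proof.
apply: eq_bigr => m _ /=; rewrite -mul_mpolyC polyCM -mulrA; congr (_ * _).
rewrite /mmap1 mpolyXE_id rmorph_prod mdegE /= -prodrXr -big_split.
by apply: eq_bigr => i _ /=; rewrite exprMn rmorphXn.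
Qed.

Lemma coef_mscale f e : (mscale f)`_e = pihomog mdeg e f.
Proof.
rewrite mscaleE coef_sum pihomogE big_mkcond [RHS]big_mkcond; apply: eq_bigr => m _ /=.
by rewrite coefCM coefXn eq_sym; case: eqP; rewrite ?mulr1 ?mulr0.
Qed.

Lemma mscaleM f g : mscale (f * g) = mscale f * mscale g.
Proof.
rewrite /mscale.
exact: (rmorphM (mmap (polyC \o @mpolyC n k) (fun i : 'I_n => ('X_i)%:P * 'X : {poly S}))).
Qed.

Lemma mscale_homog d f : f \is d.-homog -> mscale f = f *: 'X^d.
Proof.
move=> hf; apply/polyP => e; rewrite coef_mscale coefZ coefXn.
have [->|ne] := eqVneq e d; first by rewrite pihomog_dE // mulr1.
by rewrite mulr0 (pihomog_ne0 _ hf) // eq_sym.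
Qed.

End Homogeneous.

(** If [d > 0], evaluation at 0 shows that ['X] divides [p] or [q]; cancel it on both sides. *)
Lemma polyM_monomial (S : idomainType) (p q : {poly S}) a d : a != 0 ->
  p * q = a *: 'X^d -> exists b e, p = b *: 'X^e.
Proof.
elim: d p q => [|d IH] p q a0 epq.
  have /size_poly1P[c _ ->] : size p == 1%N.
    have /eqP : size (p * q) = 1%N by rewrite epq expr0 alg_polyC size_polyC a0.
    have p0 : p != 0 by apply: contraNneq a0 => p0; move: epq; rewrite p0 mul0r => /esym/eqP; rewrite expr0 alg_polyC polyC_eq0.
    have q0 : q != 0 by apply: contraNneq a0 => q0; move: epq; rewrite q0 mulr0 => /esym/eqP; rewrite expr0 alg_polyC polyC_eq0.
    rewrite size_mul //; move: p0 q0; rewrite -!size_poly_eq0.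
    by case: (size p) => // x; case: (size q) => // y _ _; rewrite addnS /= addSn eqSS addn_eq0 => /andP[/eqP->].
  by exists c, 0%N; rewrite expr0 alg_polyC.
have X0 : 'X != 0 :> {poly S} by rewrite polyX_eq0.
have : (p * q).[0] == 0 by rewrite epq hornerZ hornerXn expr0n mulr0.
rewrite hornerM mulf_eq0 => /orP[] /factor_theorem[r]; rewrite subr0 => er.
  have [//||b [e eb]] := IH r q.
    apply: (mulfI X0); move: epq; rewrite er exprS -scalerAr => <-; ring.
  by exists b, e.+1; rewrite er eb -scalerAl exprSr.
apply: (IH p r) => //; apply: (mulfI X0); move: epq; rewrite er exprS -scalerAr => <-; ring.
Qed.

(** [mscale] turns the homogeneous product into a monomial in [T], and factors of a monomial are
    monomials. *)
Lemma homog_factor (k : idomainType) n (f g : {mpoly k[n]}) d :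
  f * g != 0 -> f * g \is d.-homog -> exists e, f \is e.-homog.
Proof.
move=> fg0 /mscale_homog; rewrite mscaleM => /(polyM_monomial fg0)[b [e he]].
exists e; rewrite (pihomog_partitionE (leqnn (msize f))); apply: rpred_sum => i _.
have [<-|ne] := eqVneq (i : nat) e; first exact: pihomogP.
by rewrite -coef_mscale he coefZ coefXn (negPf ne) mulr0 dhomog0.
Qed.

Lemma mpoly_vanish (k : closedFieldType) n (f : {mpoly k[n]}) :
  (forall v, f.@[v] = 0) -> f = 0.
Proof.
elim: n f => [|n IH] f f0.
  rewrite [f]nvar0_mpolyC; have := f0 (fun _ => 0); rewrite [f]nvar0_mpolyC mevalC mcoeffC eqxx mulr1.
  by move=> ->; rewrite mpolyC0.
apply: (can_inj (@muniK k n)); rewrite muni0; apply/polyP => i; rewrite coef0.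
apply: IH => v; rewrite -(coef_map (meval v)); apply/eqP.
have [->|/closed_nonrootP[x /negP[]]] := eqVneq (map_poly (meval v) (muni f)) 0.
  by rewrite coef0.
pose w (l : 'I_n.+1) := if unlift ord_max l is Some j then v j else x.
rewrite /root; have := f0 w; rewrite -[f]muniK meval_munmap muniK => <-; apply/eqP.
have -> : w ord_max = x by rewrite /w unlift_none.
congr _.[_]; apply: eq_map_poly => c; apply: meval_eq => l; rewrite /w /=.
have -> : widen_ord (leqnSn n) l = lift ord_max l.
  by apply/val_inj; rewrite /= /bump leqNgt ltn_ord.
by rewrite liftK.
Qed.

(** * Degrees of morphisms *)

Lemma meval_homogZ (k : fieldType) n d (f : {mpoly k[n]}) (c : k) v :
  f \is d.-homog -> f.@[fun i => c * v i] = c ^+ d * f.@[v].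
Proof.
move=> /dhomogP hf; rewrite !mevalE big_distrr big_seq [RHS]big_seq /=; apply: eq_bigr => m /hf <-.
under eq_bigr do rewrite exprMn.
by rewrite big_split /= mdegE prodrXr mulrCA.
Qed.

Lemma poly_vanish_punctured (k : closedFieldType) (q : {poly k}) :
  (forall t, t != 0 -> q.[t] = 0) -> q = 0.
Proof.
move=> q0; apply/eqP; rewrite -[_ == 0]orbF -(polyX_eq0 k) -mulf_eq0.
apply/negPn/negP => /closed_nonrootP[x]; rewrite /root hornerM hornerX mulf_eq0.
by have [->|/q0->] := eqVneq x 0; rewrite ?eqxx ?orbT.
Qed.

Lemma exponent_unique (k : closedFieldType) (a b : nat) (c c' : k) : c != 0 -> c' != 0 ->
  (forall t, t != 0 -> t ^+ a * c = t ^+ b * c') -> a = b.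
Proof.
move=> c0 c0' h.
have /eqP : c *: 'X^a - c' *: 'X^b = 0 :> {poly k}.
  apply: poly_vanish_punctured => t t0.
  by rewrite hornerD hornerN !hornerZ !hornerXn mulrC h // mulrC subrr.
rewrite subr_eq0 => /eqP /(congr1 (fun p : {poly k} => size p)).
by rewrite !size_scale // !size_polyXn => -[].
Qed.

Lemma poly_noroot_const (k : closedFieldType) (q : {poly k}) :
  (forall t, q.[t] != 0) -> exists2 c, c != 0 & forall t, q.[t] = c.
Proof.
move=> qn; have /size_poly1P[c c0 ->] : size q == 1%N.
  by apply/negPn/negP => /closed_rootP[x /eqP]; apply/eqP.
by exists c => // t; rewrite hornerC.
Qed.

Section Coordinates.
Variables (k : fieldType) (V : vectType k).
Local Notation n := (\dim {:V}).

Definition coords (x : V) : 'I_n -> k := fun l => coord (vbasis {:V}) l x.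

Lemma coords_sum (v : 'I_n -> k) : coords (\sum_i v i *: (vbasis {:V})`_i) =1 v.
Proof. by move=> l; rewrite /coords coord_sum_free // (basis_free (vbasisP _)). Qed.

Lemma coords_surj (v : 'I_n -> k) : exists x, coords x =1 v.
Proof. by eexists; exact: coords_sum. Qed.

Lemma coords_inj (x y : V) : coords x =1 coords y -> x = y.
Proof.
move=> h; rewrite (coord_vbasis (memvf x)) (coord_vbasis (memvf y)).
by apply: eq_bigr => i _; rewrite -[coord _ _ _]/(coords x i) h.
Qed.

Lemma coords_neq0 (x : V) : x != 0 -> exists l, coords x l != 0.
Proof.
move=> x0; apply/existsP; apply: contraR x0 => /existsPn h; apply/eqP.
by apply: coords_inj => l; have := h l; rewrite negbK => /eqP->; rewrite /coords linear0.
Qed.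

Lemma line_poly (f : {mpoly k[n]}) (x y : V) :
  exists q : {poly k}, forall t, q.[t] = f.@[coords (x + t *: y)].
Proof.
exists (mmap polyC (fun l => (coords x l)%:P + coords y l *: 'X) f) => t.
rewrite -[LHS]/(horner_eval t _) raddf_sum; apply: eq_bigr => m _ /=.
rewrite /horner_eval hornerM hornerC /mmap1 horner_prod; congr (_ * _).
apply: eq_bigr => i _; rewrite horner_exp.
by rewrite hornerD hornerC hornerZ hornerX /coords linearD linearZ /= mulrC.
Qed.
End Coordinates.

(** * Matrices of forms that have rank one off a subspace *)

Section RankOne.
Variables (k : closedFieldType) (V W1 W2 : vectType k).
Local Notation n := (\dim {:V}).
Variables (U : V -> Prop) (W : {vspace V}) (e1 e2 : V).
Hypothesis UW : forall x, U x <-> x \notin W.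
Hypothesis e1W : forall t, e1 + t *: e2 \notin W.
Hypothesis e2W : forall t, e2 + t *: e1 \notin W.

(** Through a point [x] of [W] runs the line [x + t *: e1], which leaves [W] for [t != 0], as [e1]
    is not in [W]. On it [f] is a polynomial in [t] that vanishes off 0, hence also at 0. *)
Lemma mpoly_vanish_dense (f : {mpoly k[n]}) :
  (forall x, U x -> f.@[coords x] = 0) -> f = 0.
Proof.
move=> f0; apply: mpoly_vanish => v; have [x xv] := coords_surj v.
rewrite -(meval_eq f xv); have [xW|/UW/f0//] := boolP (x \in W).
have [q qE] := line_poly f x e1.
have q0 : q = 0.
  apply: poly_vanish_punctured => t t0; rewrite qE; apply/f0/UW.
  apply: contra (e1W 0); rewrite scale0r addr0 => h.
  have := memvB h xW; rewrite addrC addKr => /(memvZ t^-1).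
  by rewrite scalerA mulVf // scale1r.
by have := qE 0; rewrite q0 horner0 scale0r addr0.
Qed.

Variables (phi1 : V -> W1) (phi2 : V -> W2) (D : nat).
Variable C : 'I_(\dim {:W1}) -> 'I_(\dim {:W2}) -> {mpoly k[n]}.
Hypothesis C_homog : forall a b, C a b \is D.-homog.
Hypothesis C_phi : forall x, U x -> exists c, [/\ c != 0, phi1 x != 0, phi2 x != 0
  & forall a b, (C a b).@[coords x] = c * coords (phi1 x) a * coords (phi2 x) b].

Lemma has_degree_coords (W' : vectType k) (phi : V -> W') (f : 'I_(\dim {:W'}) -> {mpoly k[n]}) x :
  same_point (\sum_i (f i).@[coords x] *: (vbasis {:W'})`_i) (phi x) ->
  exists2 c, c != 0 & forall i, coords (phi x) i = c * (f i).@[coords x].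
Proof.
case=> v0 w0 [c e]; have c0 : c != 0 by apply: contraNneq v0 => c0; rewrite e c0 scale0r.
exists c^-1; rewrite ?invr_eq0 // => i.
by rewrite -(coords_sum (fun i => (f i).@[coords x])) e /coords linearZ /= mulKf.
Qed.

Lemma U_neq0 x : U x -> x != 0.
Proof. by move=> /UW; apply: contraNneq => ->; rewrite mem0v. Qed.

(* C = G f g^T with G nowhere zero on U.  So G is constant on the lines e1 + t e2
   and e2 + t e1; comparing the two constants through homogeneity gives the degree. *)
Lemma degree_sum d1 d2 : has_degree U phi1 d1 -> has_degree U phi2 d2 -> (d1 + d2)%N = D.
Proof.
move=> [f [fh fg fphi]] [g [gh gg gphi]].
have CE x : U x -> exists2 c, c != 0 &
    forall a b, (C a b).@[coords x] = c * (f a).@[coords x] * (g b).@[coords x].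
  move=> Ux; have [c [c0 _ _ e]] := C_phi Ux.
  have [c1 c10 e1'] := has_degree_coords (fphi x (U_neq0 Ux) Ux).
  have [c2 c20 e2'] := has_degree_coords (gphi x (U_neq0 Ux) Ux).
  exists (c * c1 * c2) => [|a b]; first by rewrite !mulf_neq0.
  by rewrite e e1' e2'; ring.
have nz x : U x -> exists a b, (f a).@[coords x] * (g b).@[coords x] != 0.
  move=> Ux; have [f0 _ _] := fphi x (U_neq0 Ux) Ux; have [g0 _ _] := gphi x (U_neq0 Ux) Ux.
  have [a] := coords_neq0 f0; rewrite coords_sum => ha.
  have [b] := coords_neq0 g0; rewrite coords_sum => hb.
  by exists a, b; rewrite mulf_neq0.
(* At points of [U] every column of [C] is proportional to [f], so the 2 x 2 minors vanish
   identically by density. *)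
have [h hE] : exists h : 'I__ -> {mpoly k[n]}, forall a b, C a b = h b * f a.
  suff H b : exists c, forall a, C a b = c * f a.
    by have [h hE] := choice _ H; exists h => a b.
  apply: (gcd_is_one_parallel fg) => a a'; apply/eqP; rewrite -subr_eq0; apply/eqP.
  apply: mpoly_vanish_dense => x Ux; have [c _ e] := CE x Ux.
  by rewrite mevalB !mevalM !e; ring.
have [a0 fa0] := gcd_is_one_nz fg.
have [G GE] : exists G, forall b, h b = G * g b.
  apply: (gcd_is_one_parallel gg) => b b'; apply: (mulfI fa0).
  apply/eqP; rewrite -subr_eq0; apply/eqP.
  apply: mpoly_vanish_dense => x Ux; have [c _ e] := CE x Ux.
  rewrite !mulrA ![f a0 * _]mulrC -!hE mevalB !mevalM !e; ring.
have GC x : U x -> exists a b, [/\ (f a).@[coords x] * (g b).@[coords x] != 0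
    & (C a b).@[coords x] != 0].
  move=> Ux; have [a [b fg0]] := nz x Ux; exists a, b; split=> //.
  by have [c c0 ->] := CE x Ux; rewrite -mulrA mulf_neq0.
have G0 x : U x -> G.@[coords x] != 0.
  move=> Ux; have [a [b [_]]] := GC x Ux; rewrite hE GE !mevalM.
  by apply: contraNneq => ->; rewrite !mul0r.
(* This says that [G] is homogeneous of degree [D - (d1 + d2)], in a form without subtraction. *)
have GZ x t : U x ->
    t ^+ (d1 + d2) * G.@[coords (t *: x)] = t ^+ D * G.@[coords x].
  move=> Ux; have [a [b [fg0 _]]] := GC x Ux.
  have cZ : coords (t *: x) =1 (fun l => t * coords x l) by move=> l; rewrite /coords linearZ.
  have := meval_homogZ t (coords x) (C_homog a b).
  rewrite hE GE !mevalM -!(meval_eq _ cZ) (meval_eq (f a) cZ) (meval_eq (g b) cZ).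
  rewrite (meval_homogZ _ _ (fh a)) (meval_homogZ _ _ (gh b)) exprD => E.
  apply: (mulIf fg0); apply: etrans (etrans E _); ring.
have [q1 q1E] := line_poly G e1 e2; have [q2 q2E] := line_poly G e2 e1.
have [t|c1 c10 e1E] := @poly_noroot_const _ q1; first by rewrite q1E G0 //; apply/UW.
have [t|c2 c20 e2E] := @poly_noroot_const _ q2; first by rewrite q2E G0 //; apply/UW.
(* The point [e2 + t *: e1] is [t] times [e1 + t^-1 *: e2]; so homogeneity relates the constant
   value [c2] of [G] on one line to the value [c1] on the other, for every non-zero [t]. *)
apply: (exponent_unique c20 c10) => t t0.
have e : t *: (e1 + t^-1 *: e2) = e2 + t *: e1.
  by rewrite scalerDr scalerA mulfV // scale1r addrC.
have := GZ (e1 + t^-1 *: e2) t; rewrite e -q1E -q2E e1E e2E; apply; exact/UW.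
Qed.

(** The coordinates are the primitive part [f] of one non-zero column of [C]. Its entries divide
    homogeneous entries of [C], hence are homogeneous, and all of one degree because each
    complements the degree of [h b0] to [D]. *)
Lemma degree_exists : exists d, has_degree U phi1 d.
Proof.
have Ue : U e1 by apply/UW; have := e1W 0; rewrite scale0r addr0.
have [a0 [b0 C0]] : exists a b, C a b != 0.
  have [c [c0 p1 p2 e]] := C_phi Ue.
  have [a ha] := coords_neq0 p1; have [b hb] := coords_neq0 p2.
  exists a, b; apply: contraTneq (mulf_neq0 (mulf_neq0 c0 ha) hb) => C0.
  by rewrite -e C0 meval0 eqxx.
have [|f [g [fg fE]]] := @primitive_part k n _ (fun a => C a b0); first by exists a0.
have g0 : g != 0 by apply: contraNneq C0 => g0; rewrite fE g0 mul0r.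
have [h hE] : exists h : 'I__ -> {mpoly k[n]}, forall a b, C a b = h b * f a.
  suff H b : exists c, forall a, C a b = c * f a.
    by have [h hE] := choice _ H; exists h => a b.
  apply: (gcd_is_one_parallel fg) => a a'; apply: (mulfI g0).
  rewrite mulrCA -fE [RHS]mulrCA -fE; apply/eqP; rewrite -subr_eq0; apply/eqP.
  apply: mpoly_vanish_dense => x Ux; have [c [_ _ _ e]] := C_phi Ux.
  by rewrite mevalB !mevalM !e; ring.
have nzx x : U x -> exists2 b, (h b).@[coords x] != 0 & coords (phi2 x) b != 0.
  move=> Ux; have [c [c0 p1 p2 e]] := C_phi Ux.
  have [a ha] := coords_neq0 p1; have [b hb] := coords_neq0 p2.
  exists b => //; apply: contraTneq (mulf_neq0 (mulf_neq0 c0 ha) hb) => h0.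
  by rewrite -e hE mevalM h0 mul0r eqxx.
have [h0 fa0] : h b0 != 0 /\ f a0 != 0 by move: C0; rewrite hE mulf_eq0 negb_or => /andP.
have [e he] : exists e, h b0 \is e.-homog.
  by apply: (@homog_factor _ _ _ (f a0) D); rewrite -hE.
have fh a : f a != 0 -> exists2 d, f a \is d.-homog & (e + d)%N = D.
  move=> fa; have hf0 : f a * h b0 != 0 by rewrite mulf_neq0.
  have [|d hd] := @homog_factor _ _ (f a) (h b0) D hf0; first by rewrite mulrC -hE.
  exists d => //; apply: (dhomog_uniq _ (dhomogM he hd)); last by rewrite -hE.
  by rewrite mulrC.
have [d _ ed] := fh a0 fa0.
exists d, f; split=> //.
  move=> a; have [->|/fh[d' hd' ed']] := eqVneq (f a) 0; first exact: dhomog0.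
  by have/eqP := ed; rewrite -ed' eqn_add2l => /eqP->.
move=> x x0 Ux; have [b hb pb] := nzx x Ux; have [c [c0 p1 p2 E]] := C_phi Ux.
(* The column [b0] may vanish at [x]; the column [b], chosen for this [x], does not, and it is the
   multiple of the same [f] by [h b]. *)
have fE' a : (f a).@[coords x] = c * coords (phi2 x) b / (h b).@[coords x] * coords (phi1 x) a.
  apply: (mulfI hb); rewrite -mevalM -hE E mulrA mulrCA mulfV // mulr1; ring.
have e' : \sum_i (f i).@[coords x] *: (vbasis {:W1})`_i = (c * coords (phi2 x) b / (h b).@[coords x]) *: phi1 x.
  apply: coords_inj => i; rewrite coords_sum fE' /coords linearZ //.
split=> //; last by exists (c * coords (phi2 x) b / (h b).@[coords x]).
by rewrite e' scaler_eq0 negb_or p1 andbT !mulf_neq0 ?invr_eq0.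
Qed.
End RankOne.

Lemma comp_mpoly_homog (k : fieldType) n m d (f : {mpoly k[n]}) (t : n.-tuple {mpoly k[m]}) :
  (forall i, tnth t i \is 1.-homog) -> f \is d.-homog -> f \mPo t \is d.-homog.
Proof.
move=> ht /dhomogP hf; rewrite comp_mpolyEX big_seq; apply: rpred_sum => e /hf <-.
apply: rpredZ; rewrite comp_mpolyX /= mdegE; elim/big_rec2: _ => [|i x y _ hy]; first exact: dhomog1.
by apply: dhomogM => //; have := dhomogMn (e i) (ht i); rewrite mul1n.
Qed.

(* A common factor of the composed coordinates yields, by the inverse
   substitution, a common factor of the original ones. *)
Lemma has_degree_comp (k : closedFieldType) (V W : vectType k) (U : V -> Prop) (phi : V -> W)
    (s s' : {linear V -> V}) d : cancel s s' -> cancel s' s -> (forall x, U x -> U (s x)) ->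
  has_degree U phi d -> has_degree U (phi \o s) d.
Proof.
move=> ss' s's sU [f [fh fg fphi]].
pose sub (r : {linear V -> V}) := [tuple \sum_(l < \dim {:V}) coords (r (vbasis {:V})`_l) i *: ('X_l : {mpoly k[\dim {:V}]}) | i < \dim {:V}].
have subE r x i : (tnth (sub r) i).@[coords x] = coords (r x) i.
  rewrite tnth_mktuple raddf_sum /= [in RHS](coord_vbasis (memvf x)) linear_sum /coords linear_sum.
  by apply: eq_bigr => l _; rewrite mevalZ mevalXU !linearZ /= mulrC.
have sub_homog r i : tnth (sub r) i \is 1.-homog.
  by rewrite tnth_mktuple; apply: rpred_sum => l _; apply: rpredZ; rewrite dhomogX /= mdeg1.
have compE r g x : (g \mPo sub r).@[coords x] = g.@[coords (r x)].
  by rewrite comp_mpoly_meval; apply: meval_eq => i; rewrite subE.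
have sub_can (r r' : {linear V -> V}) g : cancel r' r -> (g \mPo sub r) \mPo sub r' = g.
  move=> r'r; apply/eqP; rewrite -subr_eq0; apply/eqP/mpoly_vanish => v.
  have [x xv] := coords_surj v; rewrite -(meval_eq _ xv) mevalB !compE r'r subrr //.
exists (fun i => f i \mPo sub s); split.
- by move=> i; apply: comp_mpoly_homog.
- move=> g gE; have [i|c c0 e] := fg (g \mPo sub s').
    have [h hE] := gE i; exists (h \mPo sub s').
    by rewrite -rmorphM -hE /= sub_can.
  by exists c => //; rewrite -(sub_can s' s g) // e comp_mpolyC.
move=> x x0 Ux; have sx0 : s x != 0.
  by apply: contraNneq x0 => e; rewrite -[x]ss' e linear0.
under eq_bigr => i _ do rewrite compE.
exact: fphi (sU _ Ux).
Qed.

(** * The algebra of measures *)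

Section Augmentation.
Variables (k : fieldType) (E : finGroupScheme k).
Implicit Types u v : measures E.

Definition aug u : k^o := (u : 'Hom(_, _)) 1.

Fact aug_linear : linear aug.
Proof. by move=> c u v; rewrite /aug add_lfunE scale_lfunE. Qed.
HB.instance Definition _ := GRing.isLinear.Build k (measures E) k^o _ aug aug_linear.

Lemma measure_bilin u v :
  bilin (fun a b => (u : 'Hom(_, _)) a * (v : 'Hom(_, _)) b : k^o).
Proof. by split=> x z s t; rewrite linearP ?mulrDl ?mulrDr -?scalerAl -?scalerAr. Qed.

Lemma aug1 : aug 1 = 1.
Proof. by rewrite /aug meas1 rmorph1. Qed.

Lemma augM u v : aug (u * v) = aug u * aug v.
Proof. by rewrite /aug measM rmorph1 liftT_pure //; exact: measure_bilin. Qed.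

(* kE is the coordinate ring of the Cartier dual of E, whose Frobenius is
   trivial when all u satisfy this. *)
Definition height1 p u := u ^+ p = ((aug u : k) ^+ p) *: (1 : measures E).
End Augmentation.

Section CommHeight1.
Variables (k : fieldType) (p : nat) (charp : p \in [pchar k]) (E : finGroupScheme k).
Hypothesis comm : forall u v : measures E, u * v = v * u.

Lemma height1_0 : height1 p (0 : measures E).
Proof.
have p0 := prime_gt0 (pcharf_prime charp).
by rewrite /height1 linear0 !expr0n gtn_eqF // scale0r.
Qed.

Lemma height1_1 : height1 p (1 : measures E).
Proof. by rewrite /height1 aug1 !expr1n scale1r. Qed.

Lemma height1D (u v : measures E) : height1 p u -> height1 p v -> height1 p (u + v).
Proof.
rewrite /height1 => hu hv; have := exprD_pchar_comm charp 1 (comm u v).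
rewrite expn1 hu hv => ->; rewrite linearD /=.
have /= := exprD_pchar_comm charp 1 (mulrC (aug u) (aug v) : @GRing.comm k^o _ _).
by rewrite expn1 => ->; rewrite scalerDl.
Qed.

Lemma height1Z c (u : measures E) : height1 p u -> height1 p (c *: u).
Proof. 
have e : aug (c *: u) = c * aug u :> k by rewrite linearZ.
by rewrite /height1 => hu; rewrite e exprMn exprZn hu scalerA.
Qed.

Lemma height1M (u v : measures E) : height1 p u -> height1 p v -> height1 p (u * v).
Proof.
rewrite /height1 => hu hv; rewrite exprMn_comm // hu hv augM exprMn.
by rewrite -scalerAl mul1r scalerA.
Qed.

Lemma height1_sum I r (P : pred I) (F : I -> measures E) :
  (forall i, P i -> height1 p (F i)) -> height1 p (\sum_(i <- r | P i) F i).
Proof.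
by move=> h; elim/big_ind: _ => //; [exact: height1_0 | exact: height1D].
Qed.

Lemma height1_span (X : seq (measures E)) u :
  (forall v, v \in X -> height1 p v) -> u \in <<X>>%VS -> height1 p u.
Proof.
move=> hX uX; rewrite (coord_span (X := in_tuple X) uX); apply: height1_sum => i _.
by apply/height1Z/hX/mem_nth.
Qed.

Lemma height1_prodv (X Y : {vspace measures E}) :
  (forall u, u \in X -> height1 p u) -> (forall u, u \in Y -> height1 p u) ->
  forall u, u \in (X * Y)%VS -> height1 p u.
Proof.
move=> hX hY u; rewrite unlock; apply: height1_span => v /allpairsP[[a b] /= [aX bY ->]].
by apply: height1M; [apply: hX | apply: hY]; apply: vbasis_mem.
Qed.

Lemma height1_big n (X : 'I_n -> {vspace measures E}) :
  (forall t u, u \in X t -> height1 p u) ->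
  forall u, u \in \big[@prodv k (measures E)/1%VS]_(t < n) X t -> height1 p u.
Proof.
move=> hX; elim/big_ind: _ => [u|Y Z hY hZ|t _].
- by case/vlineP=> c ->; apply/height1Z/height1_1.
- exact: height1_prodv.
- exact: hX.
Qed.

Section Push.
Variables (G : finGroupScheme k) (i : closedEmbedding G E).

Lemma pushforwardE (u : measures G) f :
  (pushforward i u : 'Hom(_, _)) f = (u : 'Hom(_, _)) (comorphism i f).
Proof. by rewrite comp_lfunE lfunE. Qed.

Lemma pushforwardM (u v : measures G) :
  pushforward i (u * v) = pushforward i u * pushforward i v.
Proof.
apply/lfunP => f; rewrite pushforwardE !measM comorphism_comul.
rewrite [LHS](linear_liftT _ (liftT _)); apply: eq_liftT => a b.
by rewrite /= liftT_pure ?pushforwardE //; exact: measure_bilin.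
Qed.

(* pushforward 1 is a character of k[E] that is idempotent for convolution. *)
Lemma pushforward1 : pushforward i 1 = 1.
Proof.
set e := pushforward i 1.
have eM a b : (e : 'Hom(_, _)) (a * b) = (e : 'Hom(_, _)) a * (e : 'Hom(_, _)) b.
  by rewrite !pushforwardE !meas1 !rmorphM.
have e1 : (e : 'Hom(_, _)) 1 = 1 by rewrite pushforwardE meas1 !rmorph1.
have ee : e * e = e by rewrite -pushforwardM mulr1.
(* Composition with the antipode inverts a character for convolution, and an invertible idempotent
   is 1. *)
have ei : e * antipodeM e = 1.
  apply/lfunP => f; rewrite measM meas1.
  have Se b : (antipodeM e : 'Hom(_, _)) b = (e : 'Hom(_, _)) (antipode E b).
    by rewrite [LHS]comp_lfunE [linfun _ _]lfunE.
  under eq_liftT => a b do rewrite Se -eM.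
  by rewrite -[LHS]linear_liftT antipode_r linearZ /= e1 [LHS]mulr1.
by rewrite -[LHS]mulr1 -ei mulrA ee.
Qed.

Lemma pushforwardX (u : measures G) n : pushforward i (u ^+ n) = pushforward i u ^+ n.
Proof. by elim: n => [|n IH]; rewrite ?expr0 ?pushforward1 // !exprS pushforwardM IH. Qed.

Lemma aug_pushforward (u : measures G) : aug (pushforward i u) = aug u.
Proof. by rewrite /aug pushforwardE rmorph1. Qed.

Lemma height1_pushforward (u : measures G) : height1 p u -> height1 p (pushforward i u).
Proof.
by rewrite /height1 => hu; rewrite -pushforwardX hu linearZ /= pushforward1 aug_pushforward.
Qed.
End Push.
End CommHeight1.

(** * Measures of Frobenius kernels and of constant groups *)

Section DividedPowers.
Variables (k : fieldType) (p : nat) (charp : p \in [pchar k]) (r : nat).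
Local Notation q := (p ^ r)%N.
Local Notation P := (truncPoly k q).
Local Notation x := (truncX k q).
Local Notation G := (Ga_kernel charp r).

Let q_gt0 : (0 < q)%N.
Proof. by rewrite expn_gt0 prime_gt0 // (pcharf_prime charp). Qed.

Definition coef_form i (f : coordRing G) : k^o := ((f : P) : {poly k})`_i.
Fact coef_form_linear i : linear (coef_form i).
Proof. by move=> c f g; rewrite /coef_form /= coefD coefZ. Qed.
HB.instance Definition _ i := GRing.isLinear.Build k (coordRing G) k^o _ (coef_form i) (coef_form_linear i).

(* The divided powers, i.e. the basis of the measures dual to the powers of X. *)
Definition divpow i : measures G := linfun (coef_form i).

Lemma divpowE i f : (divpow i : 'Hom(_, _)) f = ((f : P) : {poly k})`_i.
Proof. by rewrite lfunE. Qed.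

Lemma truncX_expE m : (m < q)%N -> ((x ^+ m : P) : {poly k}) = 'X^m.
Proof.
move=> mq; rewrite /truncX -rmorphXn /= /mk_monic size_polyXn ltnS q_gt0 monicXn.
by rewrite Pdiv.Ring.rmodp_small // !size_polyXn ltnS.
Qed.

Lemma divpowX i m : (m < q)%N -> (divpow i : 'Hom(_, _)) (x ^+ m : P) = (i == m)%:R.
Proof. by move=> mq; rewrite divpowE truncX_expE // coefXn. Qed.

Lemma measure_ext (u v : measures G) :
  (forall m, (m < q)%N -> (u : 'Hom(_, _)) (x ^+ m : P) = (v : 'Hom(_, _)) (x ^+ m : P)) -> u = v.
Proof.
move=> uv; apply/lfunP => f; rewrite (truncPolyE q_gt0 f) !linear_sum.
by apply: eq_bigr => i _; rewrite !linearZ /= uv.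
Qed.

Lemma comul_truncX : comul G (x : P) = pureT (x : P) (1 : P) + pureT (1 : P) (x : P).
Proof. by rewrite /= truncEvalX //; exact: Ga_comul_nil. Qed.

Lemma pureTX (a b : P) m : (pureT a b : tens P P) ^+ m = pureT (a ^+ m) (b ^+ m).
Proof. by elim: m => [|m IH]; rewrite ?expr0 // !exprS IH pureTM. Qed.

(** The value of the product at [x ^+ m] is the coefficient of [x^i (x) x^l] in the m-th power of
    [x (x) 1 + 1 (x) x]. *)
Lemma divpowM i l : divpow i * divpow l = 'C(i + l, i)%:R *: divpow (i + l).
Proof.
apply: measure_ext => m mq; rewrite scale_lfunE divpowX // measM.
have -> : comul G (x ^+ m : P) = \sum_(a < m.+1) pureT (x ^+ (m - a) : P) (x ^+ a : P) *+ 'C(m, a).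
  transitivity ((pureT (x : P) (1 : P) + pureT (1 : P) (x : P)) ^+ m).
    by rewrite -comul_truncX -[RHS](rmorphXn (comul G)).
  rewrite exprDn_comm; last by rewrite /GRing.comm !pureTM !mulr1 !mul1r.
  by apply: eq_bigr => a _; rewrite !pureTX pureTM !expr1n mulr1 mul1r.
rewrite raddf_sum /=; have bl := @measure_bilin k G (divpow i) (divpow l).
under eq_bigr => a _.
  rewrite raddfMn /= (liftT_pure _ _ bl).
  have am : (a < m.+1)%N by [].
  rewrite !divpowX ?(leq_ltn_trans _ mq) ?leq_subr //.
  over.
have [e|ne] := eqVneq (i + l)%N m; last first.
  rewrite [RHS]mulr0 big1 // => a _; have [ei|] := eqVneq; last by rewrite mul0r mul0rn.
  have [el|] := eqVneq; last by rewrite mulr0 mul0rn.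
  by case/eqP: ne; rewrite ei el subnK // -ltnS.
subst m; have lm : (l < (i + l).+1)%N by rewrite ltnS leq_addl.
rewrite (bigD1 (Ordinal lm)) //= big1 => [|a /eqP ne].
  by rewrite addnK !eqxx mulr1 addr0 [RHS]mulr1 -[in RHS]bin_sub ?leq_addr // addKn.
have [el|] := eqVneq l a; last by rewrite mulr0 mul0rn.
by case: ne; apply: val_inj.
Qed.

Lemma divpow0 : divpow 0 = 1.
Proof.
apply: measure_ext => m mq; rewrite meas1 divpowX // rmorphXn /= truncEvalX //; last exact: Ga_counit_nil.
by rewrite expr0n eq_sym.
Qed.

Lemma aug_divpow i : aug (divpow i) = (i == 0)%:R.
Proof. by rewrite /aug -(divpowX i q_gt0) expr0. Qed.

Lemma divpow_exp i n : exists c, divpow i ^+ n.+1 = c *: divpow (n.+1 * i).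
Proof.
elim: n => [|n [c IH]]; first by exists 1; rewrite expr1 mul1n scale1r.
exists (c * 'C(n.+1 * i + i, n.+1 * i)%:R).
by rewrite exprSr IH -scalerAl divpowM scalerA [(n.+2 * i)%N]mulSnr.
Qed.

(** For [i > 0] the last of the multiplications contributes the binomial coefficient of [p i] over
    [i]. It is [p] times that of [p i - 1] over [i - 1], so it vanishes in [k]. *)
Lemma height1_divpow i : height1 p (divpow i).
Proof.
have pp := pcharf_prime charp.
rewrite /height1 aug_divpow; case: i => [|i]; first by rewrite divpow0 !expr1n scale1r.
rewrite expr0n gtn_eqF ?prime_gt0 // scale0r.
have [c ec] := divpow_exp i.+1 p.-2.
have p2 : p = p.-2.+2 by case: (p) (prime_gt1 pp) => [|[]].
rewrite [X in _ ^+ X]p2 exprSr ec -scalerAl divpowM -mulSnr -p2.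
suff -> : 'C(p * i.+1, p.-2.+1 * i.+1)%:R = 0 :> k by rewrite scale0r scaler0.
rewrite -bin_sub; last by rewrite {2}p2 leq_mul2r ltnW ?orbT.
have -> : (p * i.+1 - p.-2.+1 * i.+1 = i.+1)%N by rewrite -mulnBl {1}p2 subSn // subnn mul1n.
have /eqP := mul_bin_diag (p * i.+1) i.
rewrite -mulnA mulnCA eqn_pmul2l // => /eqP <-.
by rewrite natrM pcharf0 // mul0r.
Qed.

Lemma divpow_span (u : measures G) :
  u = \sum_(i < q) (u : 'Hom(_, _)) (x ^+ i : P) *: divpow i.
Proof.
apply: measure_ext => m mq; rewrite sum_lfunE (bigD1 (Ordinal mq)) //= scale_lfunE divpowX // eqxx.
rewrite [_ *: 1]mulr1 big1 ?addr0 // => i ne; rewrite scale_lfunE divpowX //.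
by rewrite -[_ == m]/(i == Ordinal mq) (negPf ne) scaler0.
Qed.
End DividedPowers.

Section GroupMeasures.
Variables (k : fieldType) (gT : finGroupType).
Local Notation G := (constGroup k gT).

Definition point_form g (f : coordRing G) : k^o := fval (f : funAlg k gT) g.
Fact point_form_linear g : linear (point_form g).
Proof. by move=> c f f'; exact: fvalP. Qed.
HB.instance Definition _ g := GRing.isLinear.Build k (coordRing G) k^o _ (point_form g) (point_form_linear g).

Definition point_measure g : measures G := linfun (point_form g).

Lemma point_measureE g f : (point_measure g : 'Hom(_, _)) f = fval (f : funAlg k gT) g.
Proof. by rewrite lfunE. Qed.

Lemma point_measureM g h : point_measure g * point_measure h = point_measure (g * h)%g.
Proof.
have bl := @measure_bilin k G (point_measure g) (point_measure h).
apply/lfunP => f; rewrite measM [LHS](liftT_constD _ bl).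
rewrite point_measureE (bigD1 g) //= (bigD1 h) //= !point_measureE !fval_delta !eqxx.
rewrite mulr1 [_ *: 1]mulr1 !big1 ?addr0 // => [x ne|y ne].
  by rewrite big1 // => y _; rewrite !point_measureE !fval_delta eq_sym (negPf ne) mul0r scaler0.
by rewrite !point_measureE !fval_delta [h == y]eq_sym (negPf ne) mulr0 scaler0.
Qed.

Lemma point_measure1 : point_measure 1%g = 1.
Proof. by apply/lfunP => f; rewrite [LHS]point_measureE [RHS]meas1. Qed.

Lemma point_measureX g n : point_measure g ^+ n = point_measure (g ^+ n)%g.
Proof. by elim: n => [|n IH]; rewrite ?expr0 ?point_measure1 // exprS expgS IH point_measureM. Qed.

Lemma aug_point_measure g : aug (point_measure g) = 1.
Proof. by rewrite /aug point_measureE /fval ffunE. Qed.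

Lemma point_measure_span (u : measures G) :
  u = \sum_g (u : 'Hom(_, _)) (delta k g) *: point_measure g.
Proof.
apply/lfunP => f; rewrite [in LHS](funAlgE f) linear_sum sum_lfunE; apply: eq_bigr => g _.
by rewrite linearZ scale_lfunE point_measureE [RHS]mulrC.
Qed.
End GroupMeasures.

(** The property passes to linear combinations and products by commutativity and characteristic [p].
    It is therefore enough to have it on bases of the factors: divided powers for Frobenius kernels,
    and group elements, where [g^p = 1], for [Z/p]. *)
Lemma elementary_abelian_height1 (k : fieldType) p (charp : p \in [pchar k])
    (E : finGroupScheme k) (u : measures E) : elementary_abelian charp E -> height1 p u.
Proof.
case=> comm [n [c [i full]]]; have pp := pcharf_prime charp.
have : u \in \big[@prodv k (measures E)/1%VS]_(t < n) submeasures (i t).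
  by rewrite full memvf.
apply: (height1_big charp comm) => t _ /memv_imgP[w _ ->]; rewrite lfunE /=.
case: (c t) (i t) w => [r|] e w; rewrite [w](divpow_span, point_measure_span) linear_sum;
  apply: (height1_sum charp comm) => s _; rewrite linearZ; apply: height1Z => //.
  by apply: height1_pushforward; exact: height1_divpow.
apply: height1_pushforward; rewrite /height1 aug_point_measure expr1n scale1r point_measureX.
rewrite -point_measure1; congr point_measure.
have cp : #|[set: 'Z_p]| = p by rewrite cardsT card_ord Zp_cast ?prime_gt1.
by rewrite -[X in (_ ^+ X)%g]cp; apply: expg_cardG; rewrite inE.
Qed.

(** * Linear forms and biduality *)

Section Duality.
Variables (k : fieldType) (V : vectType k).
Local Notation e := (vbasis {:V}).

Definition coord_form i (v : V) : k^o := coord e i v.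
Fact coord_form_linear i : linear (coord_form i).
Proof. by move=> c u v; rewrite /coord_form linearP. Qed.
HB.instance Definition _ i := GRing.isLinear.Build k V k^o _ (coord_form i) (coord_form_linear i).

Definition dual_basis i : 'Hom(V, k^o) := linfun (coord_form i).

Lemma dual_basisE i v : dual_basis i v = coord e i v.
Proof. by rewrite lfunE. Qed.

Lemma dual_basis_span (u : 'Hom(V, k^o)) : u = \sum_(i < \dim {:V}) (u e`_i : k) *: dual_basis i.
Proof.
apply/lfunP => v; rewrite [in LHS](coord_vbasis (memvf v)) linear_sum sum_lfunE.
by apply: eq_bigr => i _; rewrite linearZ scale_lfunE dual_basisE [RHS]mulrC.
Qed.

Lemma evaluation_form (L : {linear 'Hom(V, k^o) -> k^o}) : exists v, forall u, L u = u v.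
Proof.
exists (\sum_(i < \dim {:V}) (L (dual_basis i) : k) *: e`_i) => u.
rewrite [in LHS](dual_basis_span u) !linear_sum; apply: eq_bigr => i _.
by rewrite !linearZ [RHS]mulrC.
Qed.

Lemma separating_form (X : {vspace V}) x : x \notin X ->
  exists2 L : 'Hom(V, k^o), (forall y, y \in X -> L y = 0) & L x = 1.
Proof.
move=> xX; pose pi := daddv_pi (X^C)%VS X.
have dX : (X :&: X^C = 0)%VS by exact: capv_compl.
have dX' : (X^C :&: X = 0)%VS by rewrite capvC.
have piE y : pi y + daddv_pi X (X^C)%VS y = y.
  by apply: (daddv_pi_add dX'); rewrite addvC addv_complf memvf.
have piX y : y \in X -> pi y = 0.
  by move=> yX; have := piE y; rewrite (daddv_pi_id dX yX) -[RHS]add0r => /addIr.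
have pix : pi x != 0.
  apply: contra xX => /eqP px; have := piE x; rewrite px add0r => <-; exact: memv_pi.
have [l hl] := coords_neq0 pix.
pose L := (dual_basis l \o pi)%VF.
exists ((coords (pi x) l)^-1 *: L) => [y yX|]; rewrite scale_lfunE comp_lfunE dual_basisE.
  by rewrite (piX y yX) linear0 scaler0.
exact: mulVf.
Qed.
End Duality.

Lemma tens_pairing_inj (k : fieldType) (V W : vectType k) (s t : tens V W) :
  (forall (u : 'Hom(V, k^o)) (v : 'Hom(W, k^o)),
    liftT (fun a b => u a * v b : k^o) s = liftT (fun a b => u a * v b : k^o) t) -> s = t.
Proof.
have E (r : tens V W) (i : 'I_(\dim {:V})) (j : 'I_(\dim {:W})) :
    liftT (fun a b => dual_basis i a * dual_basis j b : k^o) r = (r : 'M_(_, _)) i j.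
  have fV : free (vbasis {:V}) by exact: basis_free (vbasisP _).
  have fW : free (vbasis {:W}) by exact: basis_free (vbasisP _).
  rewrite /liftT (bigD1 i) //= (bigD1 j) //= !dual_basisE !coord_free // !eqxx mulr1 [_ *: 1]mulr1.
  rewrite !big1 ?addr0 // => [l ne|l ne].
    rewrite big1 // => m _; rewrite dual_basisE coord_free // (negPf ne) mul0r scaler0 //.
  by rewrite !dual_basisE !coord_free // (negPf ne) mulr0 scaler0.
by move=> h; apply/matrixP => i j; rewrite -!E h.
Qed.

(** * The radical and derivations of the algebra of measures *)

Section LocalAlgebra.
Variables (k : fieldType) (p : nat) (charp : p \in [pchar k]) (E : finGroupScheme k).
Local Notation A := (measures E).
Hypothesis ht1 : forall u : A, height1 p u.

Let p_gt0 : (0 < p)%N. Proof. exact: prime_gt0 (pcharf_prime charp). Qed.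

Lemma aug0_nil (u : A) : aug u = 0 -> u ^+ p = 0.
Proof. by move=> u0; rewrite ht1 u0 expr0n gtn_eqF // scale0r. Qed.

Lemma aug_neq0_unit (u : A) : aug u != 0 -> exists v, v * u = 1.
Proof.
move=> u0; exists (((aug u : k) ^- p) *: u ^+ p.-1).
by rewrite -scalerAl -exprSr prednK // ht1 scalerA mulVf ?scale1r // expf_neq0.
Qed.

Lemma left_ideal_full (I : {vspace A}) u : left_ideal I -> u \in I -> aug u != 0 -> I = fullv.
Proof.
move=> lI uI /aug_neq0_unit[v vu]; apply/eqP; rewrite eqEsubv subvf /=.
apply/subvP => w _; rewrite -[w]mulr1 -vu mulrA.
by apply: (subvP lI); rewrite memv_mul ?memvf.
Qed.

(** The algebra is local: if [aug u] is non-zero, [u ^+ p] is a non-zero scalar and [u] is a unit,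
    so every proper left ideal lies in the kernel of [aug]. *)
Lemma Rad_aug (u : A) : (u \in Rad A) = (aug u == 0).
Proof.
apply/idP/eqP => [/RadP uR|u0].
  have := uR (lker (linfun (@aug k E))); rewrite memv_ker lfunE => h; apply/eqP/h.
  have lK : left_ideal (lker (linfun (@aug k E))).
    apply/prodvP => v w _; rewrite !memv_ker !lfunE /= augM => /eqP->; by rewrite mulr0.
  split=> //.
    apply: contraTneq (oner_neq0 k) => h1; have : (1 : A) \in lker (linfun (@aug k E)) by rewrite h1 memvf.
    by rewrite memv_ker lfunE /= aug1 => ->.
  move=> J lJ KJ; case: (classic (exists2 v, v \in J & aug v != 0)) => [[v vJ v0]|H].
    right; exact: left_ideal_full v0.
  left; apply/eqP; rewrite eqEsubv KJ andbT; apply/subvP => v vJ; rewrite memv_ker lfunE /=.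
  by apply/negPn/negP => v0; apply: H; exists v.
apply/RadP => I [lI nI mI]; apply/negPn/negP => uI.
pose J := (I + fullv * <[u]>)%VS.
have lJ : left_ideal J.
  rewrite /left_ideal /J prodvDr prodvA subv_add; apply/andP; split.
    by apply: subv_trans lI _; rewrite addvSl.
  by apply: subv_trans (addvSr _ _); rewrite prodvSl // subvf.
have [|e|e] := mI J lJ; first exact: addvSl.
  case/negP: uI; rewrite -e; apply: (subvP (addvSr _ _)).
  by have := memv_mul (memvf (1 : A)) (memv_line u); rewrite mul1r.
have : (1 : A) \in J by rewrite e memvf.
case/memv_addP => i iI [w wu e1]; case/eqP: nI; apply: (left_ideal_full lI iI).
have w0 : aug w = 0.
  have /subvP/(_ w wu) : (fullv * <[u]> <= lker (linfun (@aug k E)))%VS.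
    apply/prodvP => a b _ /vlineP[c ->]; rewrite memv_ker lfunE /= augM linearZ /= u0.
    by rewrite scaler0 mulr0.
  by rewrite memv_ker lfunE => /eqP.
by have := congr1 (@aug k E) e1; rewrite aug1 linearD /= w0 addr0 => <-; rewrite oner_eq0.
Qed.

Section Derivation.
Variable h : coordRing E.
Hypothesis h_prim : comul E h = pureT h 1 + pureT 1 h.

Definition deriv_at (u : A) : A :=
  (u \o linfun (h \*o idfun))%VF.

Lemma deriv_atE u f : (deriv_at u : 'Hom(_, _)) f = (u : 'Hom(_, _)) (h * f).
Proof. by rewrite comp_lfunE lfunE. Qed.

Lemma deriv_atM u v : deriv_at (u * v) = deriv_at u * v + u * deriv_at v.
Proof.
apply/lfunP => f; rewrite add_lfunE deriv_atE !measM.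
have -> : comul E (h * f) = (pureT h 1 + pureT 1 h) * comul E f by rewrite -h_prim; exact: rmorphM.
move: (comul E f : tens _ _).
apply: tens_ext => [c x y|c x y|a b].
- by rewrite mulrDr -scalerAr linearP.
- by rewrite !linearP /= scalerDr addrACA.
by rewrite mulrDl !pureTM linearD /= !liftT_pure ?deriv_atE ?mul1r //; exact: measure_bilin.
Qed.
End Derivation.

(** By biduality [h] is a linear form [L] on [kE]. Take [L] to vanish on [Rad^2] and on 1, with
    [L x = 1]. Splitting [u] and [v] into scalar and radical parts gives
    [L (u v) = aug u L v + aug v L u], which says that [h] is primitive. *)
Lemma primitive_form (x : A) : x \in Rad A -> x \notin (Rad A * Rad A)%VS ->
  exists h, comul E h = pureT h 1 + pureT 1 h /\ (x : 'Hom(_, _)) h = 1.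
Proof.
move=> xR xR2; pose X := (Rad A * Rad A + <[1]>)%VS.
have augR2 w : w \in (Rad A * Rad A)%VS -> aug w = 0.
  have /subvP sub : (Rad A * Rad A <= lker (linfun (@aug k E)))%VS.
    apply/prodvP => a b; rewrite !Rad_aug => /eqP a0 _.
    by rewrite memv_ker lfunE /= augM a0 mul0r.
  by move/sub; rewrite memv_ker lfunE => /eqP.
have xX : x \notin X.
  apply: contra xR2 => /memv_addP[r rR [_ /vlineP[c ->] e]].
  have := congr1 (@aug k E) e; rewrite linearD linearZ /= aug1 (augR2 r rR) add0r [_ *: 1]mulr1.
  by move: xR; rewrite Rad_aug => /eqP-> c0; rewrite e -c0 scale0r addr0.
have [L LX Lx] := separating_form xX.
have [h hE] := evaluation_form L.
exists h; split; last by rewrite -hE.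
apply: tens_pairing_inj => u v; move: (u : A) (v : A) => {}u {}v.
have bl := @measure_bilin k E u v.
rewrite linearD /= !(liftT_pure _ _ bl) -[LHS](measM u v).
have dec (w : A) : exists2 w0, w0 \in Rad A & w = (aug w : k)%:A + w0.
  exists (w - (aug w : k)%:A); last by rewrite addrC subrK.
  by rewrite Rad_aug linearB linearZ /= aug1 [_ *: 1]mulr1 subrr.
have h1 : (1 : A) h = 0.
  by rewrite -[LHS]hE; apply: LX; apply: (subvP (addvSr _ _)); exact: memv_line.
have hk (w w0 : A) : w0 \in Rad A -> w = (aug w : k)%:A + w0 -> (w : 'Hom(_, _)) h = (w0 : 'Hom(_, _)) h.
  by move=> _ e; rewrite [in LHS]e add_lfunE scale_lfunE h1 scaler0 add0r.
have [u0 uR eu] := dec u; have [v0 vR ev] := dec v.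
have e : u * v = (aug u * aug v : k)%:A + ((aug u : k) *: v0 + (aug v : k) *: u0 + u0 * v0).
  rewrite [in LHS]eu [in LHS]ev mulrDl !mulrDr -!scalerAl -!scalerAr !mul1r !mulr1 scalerA.
  by rewrite !addrA.
have h2 : (u0 * v0 : A) h = 0.
  by rewrite -[LHS]hE; apply: LX; apply: (subvP (addvSl _ _)); exact: memv_mul.
rewrite e !add_lfunE !scale_lfunE h1 h2 (hk u u0) // (hk v v0) // scaler0 add0r addr0 addrC.
by congr (_ + _); exact: mulrC.
Qed.

End LocalAlgebra.

(** * p-points *)

(* Differentiating x^(i+1) b = 0 shows that x^i b is divisible by x^(i+1). *)
Lemma derivation_ker (R : comNzRingType) (D : R -> R) (x w : R) p :
  D 0 = 0 -> (forall u v, D (u * v) = D u * v + u * D v) -> w * D x = 1 ->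
  (forall n, (0 < n < p)%N -> exists c : R, c * n%:R = 1) ->
  forall a, x * a = 0 -> forall i, (i < p)%N -> exists b, a = x ^+ i * b.
Proof.
move=> D0 DM wDx inv a xa0; elim=> [|i IH] ip; first by exists a; rewrite expr0 mul1r.
have [b e] := IH (ltnW ip); have [c ce] := inv i.+1 ip.
have DX n : D (x ^+ n.+1) = n.+1%:R * x ^+ n * D x.
  elim: n => [|n IHn]; first by rewrite expr1 expr0 mulr1 mul1r.
  by rewrite exprS DM IHn -[in RHS]natr1 !exprS; ring.
have : D (x ^+ i.+1 * b) = 0 by rewrite exprS -mulrA -e xa0 D0.
rewrite DM DX => /eqP; rewrite addr_eq0 => /eqP De.
exists (- (c * w * D b)).
transitivity (c * w * (i.+1%:R * x ^+ i * D x * b)).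
  rewrite e; transitivity ((c * i.+1%:R) * (w * D x) * (x ^+ i * b)); last by ring.
  by rewrite ce wDx !mul1r.
by rewrite De; ring.
Qed.

(** * Freeness over a truncated polynomial ring *)

Section FreeOverTruncPoly.
Variables (k : fieldType) (p : nat) (A : falgType k).
Hypothesis p_gt0 : (0 < p)%N.
Variable alpha : {lrmorphism truncPoly k p -> A}.
Local Notation x := (alpha (truncX k p)).
Local Notation t := (truncX k p).
Hypothesis x_ker : forall a, x * a = 0 -> exists b, a = x ^+ p.-1 * b.

Lemma xX n : x ^+ n = alpha (t ^+ n). Proof. by rewrite rmorphXn. Qed.

Lemma x_nil : x ^+ p = 0. Proof. by rewrite xX truncX_nil // rmorph0. Qed.

(** If [x^(n+1) a = 0], then [x^n a = x^(p-1) b]. Subtracting [x^(p-1-n) b] from [a] reduces to [n],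
    and this correction is a multiple of [x] because [n < p - 1]. *)
Lemma x_pow_ker n a : (n < p)%N -> x ^+ n * a = 0 -> exists b, a = x * b.
Proof.
elim: n a => [|n IH] a np; first by rewrite expr0 mul1r => ->; exists 0; rewrite mulr0.
rewrite exprS -mulrA => /x_ker[b e].
have [|c ec] := IH (a - x ^+ (p.-1 - n) * b) (ltnW np).
  rewrite mulrBr e mulrA -exprD subnKC ?subrr // -ltnS prednK //; exact: ltnW.
have n1 : (0 < p.-1 - n)%N by rewrite subn_gt0 -ltnS prednK.
exists (c + x ^+ (p.-1 - n).-1 * b).
by rewrite mulrDr -ec mulrA -exprS prednK // subrK.
Qed.

(** A basis of a complement of [x A], that is, a lift of a basis of [A / x A], will be a basis of
    [A] over the truncated polynomial ring. *)
Let I : {vspace A} := limg (linfun (x \*o idfun)).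
Let V := (I^C)%VS.
Let v (i : 'I_(\dim V)) : A := (vbasis V)`_i.

Lemma memI a : (a \in I) <-> exists b, a = x * b.
Proof.
split=> [/memv_imgP[b _ ->]|[b ->]]; first by exists b; rewrite lfunE.
by apply/memv_imgP; exists b; rewrite ?memvf // lfunE.
Qed.

Lemma truncPoly_split (s : truncPoly k p) : exists c s', s = c%:A + t * s'.
Proof.
rewrite (truncPolyE p_gt0 s); move: p_gt0; case: (p) s => // n s _.
rewrite big_ord_recl /= expr0; eexists; eexists; congr (_ + _).
have -> : \sum_(i < n) (s : {poly k})`_(bump 0 i) *: truncX k n.+1 ^+ bump 0 i =
   truncX k n.+1 * \sum_(i < n) (s : {poly k})`_(bump 0 i) *: truncX k n.+1 ^+ i.
  by rewrite mulr_sumr; apply: eq_bigr => i _; rewrite -scalerAr -exprS.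
reflexivity.
Qed.

(** Successive approximation modulo [x^n] by means of [A = V + x A]; it ends because [x^p = 0]. *)
Lemma free_gen a : exists s : 'I_(\dim V) -> truncPoly k p, a = \sum_i alpha (s i) * v i.
Proof.
suff H n : exists s r, a = \sum_i alpha (s i) * v i + x ^+ n * r.
  by have [s [r ->]] := H p; exists s; rewrite x_nil mul0r addr0.
elim: n => [|n [s [r e]]].
  by exists (fun _ => 0), a; rewrite big1 ?expr0 ?mul1r ?add0r // => i _; rewrite rmorph0 mul0r.
have : r \in (V + I)%VS by rewrite addvC addv_complf memvf.
case/memv_addP => r1 r1V [r2 /memI[b ->]] er.
exists (fun i => s i + coord (vbasis V) i r1 *: t ^+ n), b.
rewrite e er mulrDr mulrA -exprSr addrA; congr (_ + _).
rewrite [in LHS](coord_vbasis r1V) mulr_sumr -big_split; apply: eq_bigr => i _ /=.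
by rewrite linearD mulrDl linearZ /= -xX -scalerAl -scalerAr.
Qed.

(** All [s i] are divisible by [t^n] for each [n <= p], by induction: by [x_pow_ker] the constant
    terms of the quotients give a combination of the [v i] that lies in [x A], hence in [x A] and
    [V] both, so they vanish. *)
Lemma free_indep (s : 'I_(\dim V) -> truncPoly k p) :
  \sum_i alpha (s i) * v i = 0 -> forall i, s i = 0.
Proof.
move=> s0; suff H n : (n <= p)%N -> exists s', forall i, s i = t ^+ n * s' i.
  by have [s' e] := H p (leqnn _) => i; rewrite e truncX_nil // mul0r.
elim: n => [|n IH] np; first by exists s => i; rewrite expr0 mul1r.
have [s' e] := IH (ltnW np).
have [c cE] := choice _ (fun i => truncPoly_split (s' i)).
have [s'' sE] := choice _ cE.
suff c0 i : c i = 0.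
  by exists s'' => i; rewrite e sE c0 scale0r add0r mulrA -exprSr.
have : \sum_i c i *: v i \in (I :&: V)%VS.
  rewrite memv_cap; apply/andP; split; last by apply: memv_suml => l _; rewrite memvZ // vbasis_mem // mem_nth // size_tuple.
  apply/memI; pose S := \sum_i alpha (s'' i) * v i.
  have eS : x ^+ n * (\sum_i c i *: v i + x * S) = 0.
    rewrite -[RHS]s0 mulr_sumr -big_split mulr_sumr; apply: eq_bigr => l _ /=.
    have -> : alpha (s l) = alpha (t ^+ n) * (alpha (c l)%:A + alpha (t * s'' l)).
      by rewrite e sE rmorphM rmorphD.
    by rewrite -xX linearZ /= rmorph1 rmorphM -mulrA mulrDl -scalerAl mul1r mulrA.
  have [b eb] := x_pow_ker np eS; exists (b - S).
  by rewrite mulrBr -eb addrK.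
rewrite capv_compl memv0 => /eqP cv0.
have /freeP : free (vbasis V) by exact: basis_free (vbasisP _).
exact.
Qed.

Lemma restrict_projective : projective (restrict alpha).
Proof.
move=> N N' g f gsurj.
have [s sE] := choice _ free_gen.
have [n nE] := choice _ (fun i => gsurj (f (v i))).
have uniq_s a (r : 'I_(\dim V) -> truncPoly k p) : a = \sum_i alpha (r i) * v i -> s a =1 r.
  move=> e i; apply/eqP; rewrite -subr_eq0; apply/eqP.
  move: i; apply: free_indep.
  transitivity (\sum_i alpha (s a i) * v i - \sum_i alpha (r i) * v i).
    by rewrite -sumrB; apply: eq_bigr => i _; rewrite rmorphB mulrBl.
  by rewrite -sE -e subrr.
pose h (a : restrict alpha) : N := \sum_i s a i *: n i.
have hlin : linear h.
  move=> c a b; have sl : s (c *: a + b) =1 (fun i => c * s a i + s b i); last first.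
    rewrite /h scaler_sumr -big_split; apply: eq_bigr => i _ /=.
    by rewrite sl scalerDl scalerA.
  apply: uniq_s.
  have -> : c *: a + b = alpha c * (a : A) + (b : A) by [].
  rewrite {1}(sE a) {1}(sE b) mulr_sumr -big_split; apply: eq_bigr => i _ /=.
  by rewrite rmorphD rmorphM mulrDl mulrA.
pose h' : {linear restrict alpha -> N} :=
  HB.pack h (GRing.isLinear.Build (truncPoly k p) (restrict alpha) N _ h hlin).
exists h' => a /=.
have ea : a = \sum_i s a i *: (v i : restrict alpha) by exact: sE.
rewrite [in RHS]ea /h !linear_sum; apply: eq_bigr => i _.
by rewrite !linearZ /= nE.
Qed.
End FreeOverTruncPoly.

Section PPoints.
Variables (k : fieldType) (p : nat) (charp : p \in [pchar k]) (E : finGroupScheme k).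
Local Notation A := (measures E).
Hypothesis comm : forall u v : A, u * v = v * u.
Hypothesis ht1 : forall u : A, height1 p u.

Let p_gt0 : (0 < p)%N. Proof. exact: prime_gt0 (pcharf_prime charp). Qed.

Lemma ppoint_of_Rad (x : A) : x \in Rad A -> x \notin (Rad A * Rad A)%VS ->
  exists alpha : ppoint p E, ppoint_t alpha = x.
Proof.
move=> xR xR2; have [h [hp hx]] := primitive_form charp ht1 xR xR2.
have x_nil : x ^+ p = 0 by apply: (aug0_nil charp ht1); apply/eqP; rewrite -(Rad_aug charp ht1).
pose alpha := truncEvalMorph p_gt0 x_nil.
have ax : alpha (truncX k p) = x by exact: (truncEvalX p_gt0 x_nil).
(* The augmentation of the derivative of [x] is [x (h * 1) = 1]. *)
have [w wDx] : exists w, w * deriv_at h x = 1.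
  by apply: (aug_neq0_unit charp ht1); rewrite /aug deriv_atE mulr1 hx oner_eq0.
pose A' : comNzRingType := HB.pack A (GRing.PzSemiRing_hasCommutativeMul.Build A comm).
have inv n : (0 < n < p)%N -> exists c : A', c * n%:R = 1.
  case/andP=> n0 np; have nk : n%:R != 0 :> k.
    by rewrite -(dvdn_pcharf charp); apply: contraL np => /dvdn_leq; rewrite -leqNgt; apply.
  exists ((n%:R^-1 : k)%:A : A); rewrite -[LHS]/(((n%:R^-1 : k)%:A : A) * n%:R).
  by rewrite -scalerAl mul1r -scaler_nat scalerA mulVf // scale1r.
have D0 : deriv_at h (0 : A) = 0.
  by apply/lfunP => f; rewrite deriv_atE !zero_lfunE.
have := @derivation_ker A' (deriv_at h) x w p D0 (deriv_atM hp) wDx inv.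
move=> ker; have ker' a : alpha (truncX k p) * a = 0 -> exists b, a = alpha (truncX k p) ^+ p.-1 * b.
  by rewrite ax => /ker; apply; rewrite prednK.
exists (PPoint (restrict_projective p_gt0 ker')).
exact: ax.
Qed.

End PPoints.

(** * The antipode and p-points *)

Section Antipode.
Variables (k : fieldType) (E : finGroupScheme k).
Local Notation H := (coordRing E).
Local Notation S := (antipode E).

(* S * (S \o S) = 1 for convolution, because Delta (S f) = S f_2 (x) S f_1. *)
Lemma antipodeK : involutive S.
Proof.
move=> f; have lid : linear (fun a : H => a) by [].
have lS : linear (fun a => S a) by exact: linearP.
have lSS : linear (fun a => S (S a)) by move=> c a b; rewrite !linearP.
have SSS g : conv (fun a => S a) (fun a => S (S a)) g = convun H g.
  have := antipode_l (S g); rewrite counit_antipode comul_antipode.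
  have bl : bilin (fun a b : H => S a * b).
    by split=> w c a b; rewrite ?linearP ?mulrDl ?mulrDr -?scalerAl -?scalerAr.
  rewrite [LHS](linear_liftT _ (liftT _)) => e; rewrite -[RHS]e; apply: eq_liftT => a b /=.
  by rewrite liftT_pure // coordRing_comm.
have idS g : conv (fun a => a) (fun a => S a) g = convun H g by exact: antipode_r.
rewrite -[LHS](conv1l lSS) -[RHS](conv1 lid).
transitivity (conv (conv (fun a => a) (fun a => S a)) (fun a => S (S a)) f).
  by apply: eq_liftT => a b; rewrite idS.
rewrite -convA //; by apply: eq_liftT => a b; rewrite SSS.
Qed.

Lemma antipodeMK : involutive (@antipodeM k E).
Proof.
by move=> u; apply/lfunP => f; rewrite !comp_lfunE !lfunE /= antipodeK.
Qed.

Lemma aug_antipodeM (u : measures E) : aug (antipodeM u) = aug u.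
Proof. by rewrite /aug comp_lfunE lfunE /= antipode1. Qed.
End Antipode.

Lemma projective_transport (R A : nzRingType) (alpha beta : {rmorphism R -> A}) (s s' : {additive A -> A}) :
  cancel s s' -> cancel s' s -> (forall r a, s (alpha r * a) = beta r * s a) ->
  projective (restrict alpha) -> projective (restrict beta).
Proof.
move=> ss' s's sM P N N' g f gs.
pose f' (a : restrict alpha) : N' := f (s a : restrict beta).
have f'lin : linear f'.
  move=> c a b; rewrite /f' -[c *: a + b]/(alpha c * (a : A) + (b : A)) raddfD sM.
  by rewrite -[beta c * _ + _]/(c *: (s a : restrict beta) + (s b : restrict beta)) linearP.
pose F : {linear restrict alpha -> N'} := HB.pack f' (GRing.isLinear.Build R (restrict alpha) N' _ f' f'lin).
have [h hE] := P N N' g F gs.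
pose h' (a : restrict beta) : N := h (s' a : restrict alpha).
have s'M r a : s' (beta r * a) = alpha r * s' a.
  by apply: (can_inj ss'); rewrite s's sM s's.
have h'lin : linear h'.
  move=> c a b; rewrite /h' -[c *: a + b]/(beta c * (a : A) + (b : A)) raddfD s'M.
  by rewrite -[alpha c * _ + _]/(c *: (s' a : restrict alpha) + (s' b : restrict alpha)) linearP.
pose H : {linear restrict beta -> N} := HB.pack h' (GRing.isLinear.Build R (restrict beta) N _ h' h'lin).
by exists H => a; rewrite /= /h' hE /= /f' s's.
Qed.

(** By commutativity the antipode is an algebra automorphism, so it transports projectivity along
    any p-point. This is what compares the ranks on [M] and on its dual. *)
Lemma ppoint_antipode (k : fieldType) p (E : finGroupScheme k) (alpha : ppoint p E) :
  (forall u v : measures E, u * v = v * u) ->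
  exists beta : ppoint p E, ppoint_t beta = antipodeM (ppoint_t alpha).
Proof.
move=> comm; pose a := ppoint_map alpha.
pose b r := antipodeM (a r).
have blin : linear b by move=> c u v; rewrite /b !linearP.
have bmul : monoid_morphism b.
  by split=> [|u v]; rewrite /b ?rmorph1 ?antipodeM1 // rmorphM antipodeMM comm.
pose B : {lrmorphism truncPoly k p -> measures E} :=
  HB.pack b (GRing.isLinear.Build k (truncPoly k p) (measures E) _ b blin)
    (GRing.isMonoidMorphism.Build (truncPoly k p) (measures E) b bmul).
have PB : projective (restrict B).
  pose s : {additive measures E -> measures E} := @antipodeM k E.
  apply: (@projective_transport _ _ a B s s (@antipodeMK k E) (@antipodeMK k E)).
    by move=> r u; rewrite /= antipodeMM comm.
  exact: ppoint_projective.
by exists (PPoint PB).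
Qed.

(** * Minors and Pluecker coordinates *)

Section Plucker.
Variables (k : fieldType) (W : vectType k).
Local Notation n := (\dim {:W}).

Definition coord_mx (d : nat) (X : {vspace W}) : 'M[k]_(d, n) :=
  \matrix_(a < d, i < n) coords (vbasis X)`_a i.

Lemma pluckerE d (X : {vspace W}) (J : increasing d n) :
  (plucker d X : {ffun _ -> _}) J = \det (colsub (val J) (coord_mx d X)).
Proof. by rewrite ffunE; congr (\det _); apply/matrixP => a b; rewrite !mxE. Qed.

Lemma coord_mx_free (X : {vspace W}) : row_free (coord_mx (\dim X) X).
Proof.
apply: inj_row_free => z z0.
have fX : free (vbasis X) by exact: basis_free (vbasisP _).
have /freeP/(_ (fun a => z 0 a)) h := fX.
apply/rowP => a; rewrite mxE; apply: h; apply: coords_inj => i.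
have := congr1 (fun B : 'rV_n => B 0 i) z0; rewrite !mxE => e.
rewrite /coords linear_sum linear0 -[RHS]e.
by apply: eq_bigr => b _; rewrite linearZ mxE.
Qed.

(* A column selection with nonzero minor maximising sum_a a * f a is increasing:
   exchanging two columns in the wrong order would increase the sum. *)
Lemma row_free_increasing d (B : 'M[k]_(d, n)) : row_free B ->
  exists J : increasing d n, \det (colsub (val J) B) != 0.
Proof.
move=> fB.
have fBT : row_full B^T by rewrite /row_full mxrank_tr.
pose good (f : {ffun 'I_d -> 'I_n}) := \det (colsub f B) != 0.
have g0 : good (fullrankfun fBT).
  have := fullrowsub_unit fBT; rewrite unitmxE unitfE -det_tr /good.
  by congr (\det _ != 0); apply/matrixP => a b; rewrite !mxE.
pose w (f : {ffun 'I_d -> 'I_n}) := (\sum_(a < d) a * f a)%N.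
case: (arg_maxnP w g0) => f gf fmax.
have inc : [forall a : 'I_d, forall b : 'I_d, (a < b)%N ==> (f a < f b)%N].
  apply/forallP => a; apply/forallP => b; apply/implyP => ab; rewrite ltnNge; apply/negP => fba.
  have neab : a != b by rewrite -val_eqE /= ltn_eqF.
  have [e|ne] := eqVneq (f a) (f b).
    move: gf; rewrite /good -det_tr (determinant_alternate neab) ?eqxx // => i.
    by rewrite !mxE e.
  have fab : (f b < f a)%N by rewrite ltn_neqAle fba andbT eq_sym.
  pose f' : {ffun 'I_d -> 'I_n} := [ffun c => f (tperm a b c)].
  have gf' : good f'.
    have -> : good f' = good f; last exact: gf.
    rewrite /good; have -> : colsub f' B = col_perm (tperm a b) (colsub f B).
      by apply/matrixP => i c; rewrite !mxE ffunE.
    by rewrite col_permE det_mulmx det_perm mulf_eq0 signr_eq0 orbF.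
  have : (w f' <= w f)%N by exact: fmax.
  rewrite /w leqNgt => /negP; apply.
  rewrite (bigD1 a) //= (bigD1 b) 1?eq_sym //= [X in (_ < X)%N](bigD1 a) //=.
  rewrite [X in (_ < _ + X)%N](bigD1 b) 1?eq_sym //= !ffunE tpermL tpermR !addnA.
  have -> : (\sum_(i < d | (i != a) && (i != b)) i * f' i = \sum_(i < d | (i != a) && (i != b)) i * f i)%N.
    by apply: eq_bigr => c /andP[ca cb]; rewrite ffunE tpermD // eq_sym.
  rewrite ltn_add2r; move: ab fab; move: (nat_of_ord a) (nat_of_ord b) (nat_of_ord (f a)) (nat_of_ord (f b)).
  by move=> x y s t xy ts; nia.
exists (exist _ f inc); exact: gf.
Qed.
End Plucker.

(** The basis [vbasis] of the dual space need not be dual to that of [M]. The vectors [w l] form the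
    basis of [M] to which it is dual. *)
Lemma dual_family (k : fieldType) (M : vectType k) :
  exists w : 'I_(\dim {:'Hom(M, k^o)}) -> M,
    forall l (phi : 'Hom(M, k^o)), coords phi l = phi (w l).
Proof.
suff H l : exists v, forall phi : 'Hom(M, k^o), coords phi l = phi v by exact: (choice _ H).
exact: (evaluation_form (@coord_form k 'Hom(M, k^o) l)).
Qed.

Section TransposedMinors.
Variables (k : fieldType) (M : vectType k).
Local Notation M' := 'Hom(M, k^o).
Variables (T : 'End(M)) (T' : 'End(M')) (w : 'I_(\dim {:M'}) -> M).
Hypothesis T'E : forall phi : M', T' phi = (phi \o T)%VF.
Hypothesis wE : forall l (phi : M'), coords phi l = phi (w l).

(** One matrix for both operators: its columns are the coordinates of vectors spanning the image of
    [T], its rows those of forms spanning the image of the transpose [T']. *)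
Definition pairing_mx : 'M[k]_(\dim {:M}, \dim {:M'}) := \matrix_(i, l) coords (T (w l)) i.
Local Notation G := pairing_mx.
Local Notation d1 := (\dim (limg T)).
Local Notation d2 := (\dim (limg T')).
Local Notation B1 := (coord_mx d1 (limg T)).
Local Notation B2 := (coord_mx d2 (limg T')).

Lemma coords_expand (W : vectType k) (X : {vspace W}) x i : x \in X ->
  coords x i = \sum_(a < \dim X) coord (vbasis X) a x * coord_mx (\dim X) X a i.
Proof.
move=> xX; rewrite {1}(coord_vbasis xX) /coords linear_sum; apply: eq_bigr => a _.
by rewrite linearZ mxE.
Qed.

Lemma pairing_mx_dual i l : G i l = coords (T' (dual_basis i)) l.
Proof. by rewrite mxE wE T'E comp_lfunE dual_basisE. Qed.

Lemma dual_family_span v : v = \sum_(l < \dim {:M'}) ((vbasis {:M'})`_l v : k) *: w l.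
Proof.
apply: coords_inj => i; rewrite -[LHS]dual_basisE -[RHS]dual_basisE.
rewrite linear_sum {1}(coord_vbasis (memvf (dual_basis i))) sum_lfunE; apply: eq_bigr => l _.
by rewrite scale_lfunE [RHS]linearZ /= -wE [RHS]mulrC.
Qed.

(** A rank factorisation along bases of the column space and the row space. The basis vectors are
    themselves combinations of columns, respectively rows, of [G], which makes [K] invertible on
    both sides. *)
Lemma pairing_mx_factor : exists (K : 'M[k]_(d1, d2)) (Z : 'M_(d2, d1)) (Z' : 'M_(d2, d1)),
  [/\ G = B1^T *m K *m B2, Z *m K = 1%:M & K *m Z' = 1%:M].
Proof.
have /row_freeP[R1 R1E] := coord_mx_free (limg T).
have /row_freeP[R2 R2E] := coord_mx_free (limg T').
pose Y : 'M[k]_(d1, _) := \matrix_(a, l) coord (vbasis (limg T)) a (T (w l)).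
pose Q : 'M[k]_(_, d2) := \matrix_(i, b) coord (vbasis (limg T')) b (T' (dual_basis i)).
have GY : G = B1^T *m Y.
  apply/matrixP => i l; rewrite !mxE (coords_expand _ (memv_img T (memvf _))).
  by apply: eq_bigr => a _; rewrite [in RHS]mxE [X in _ = _ * X]mxE mulrC.
have GQ : G = Q *m B2.
  apply/matrixP => i l; rewrite pairing_mx_dual (coords_expand _ (memv_img T' (memvf _))) mxE.
  by apply: eq_bigr => b _; rewrite [X in _ = X * _]mxE.
have [Z1 Z1E] : exists Z1, B2 = Z1 *m G.
  (* Here [b] is any natural number; the second alternative covers the indices beyond the basis. *)
  have H b : exists phi, (vbasis (limg T'))`_b = T' phi \/ (d2 <= b)%N.
    case: (ltnP b d2) => bd; last by exists 0; right.
    have : (vbasis (limg T'))`_b \in limg T' by apply: vbasis_mem; rewrite mem_nth // size_tuple.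
    by case/memv_imgP => phi _ ->; exists phi; left.
  have [phi phiE] := choice _ H.
  exists (\matrix_(b, i) (phi b (vbasis {:M})`_i : k)); apply/matrixP => b l; rewrite !mxE.
  case: (phiE b) => [->|]; last by rewrite leqNgt ltn_ord.
  rewrite {1}(dual_basis_span (phi b)) linear_sum /coords linear_sum; apply: eq_bigr => i _.
  by rewrite !linearZ /= [in RHS]mxE pairing_mx_dual.
have [Z2 Z2E] : exists Z2, B1 = Z2 *m G^T.
  have H a : exists v, (vbasis (limg T))`_a = T v \/ (d1 <= a)%N.
    case: (ltnP a d1) => ad; last by exists 0; right.
    have : (vbasis (limg T))`_a \in limg T by apply: vbasis_mem; rewrite mem_nth // size_tuple.
    by case/memv_imgP => v _ ->; exists v; left.
  have [v vE] := choice _ H.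
  exists (\matrix_(a, l) ((vbasis {:M'})`_l (v a) : k)); apply/matrixP => a i; rewrite !mxE.
  case: (vE a) => [->|]; last by rewrite leqNgt ltn_ord.
  rewrite {1}(dual_family_span (v a)) linear_sum /coords linear_sum; apply: eq_bigr => l _.
  by rewrite !linearZ /= !mxE.
pose K := Y *m R2.
have QK : Q = B1^T *m K by rewrite mulmxA -GY GQ -mulmxA R2E mulmx1.
have GK : G = B1^T *m K *m B2 by rewrite -QK.
exists K, (Z1 *m B1^T), (B2 *m Z2^T); split=> //.
  have := congr1 (mulmx^~ R2) Z1E; rewrite R2E GK => ->.
  by rewrite -!mulmxA R2E mulmx1.
have := congr1 (fun X => (X *m R1)^T) Z2E; rewrite R1E trmx1 GK => ->.
rewrite !trmx_mul !trmxK !mulmxA -trmx_mul R1E trmx1 mul1mx //.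
Qed.

Lemma dim_limg_dual : d2 = d1.
Proof.
have [K [Z [Z' [_ ZK KZ]]]] := pairing_mx_factor.
by apply/eqP; rewrite eqn_leq (mulmx1_min ZK) (mulmx1_min KZ).
Qed.

(** A minor of size [d] of [B1^T K B2] is a product of three determinants of size [d], as [K] is
    square of that size; [c] is the determinant of [K]. So the matrix of minors has rank one. *)
Lemma pairing_minors d : d1 = d -> exists2 c : k, c != 0 & forall (I : increasing d _) (J : increasing d _),
  \det (mxsub (val I) (val J) G) =
    c * (plucker d (limg T) : {ffun _ -> _}) I * (plucker d (limg T') : {ffun _ -> _}) J.
Proof.
move=> e1; have e2 : d2 = d by rewrite dim_limg_dual.
(* The two dimensions occur in the matrix types; they are made variables so that both can become
   [d]. *)
have factor r r' : d1 = r -> d2 = r' -> exists (K : 'M[k]_(r, r')) (Z : 'M_(r', r)),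
    G = (coord_mx r (limg T))^T *m K *m coord_mx r' (limg T') /\ Z *m K = 1%:M.
  by move=> <- <-; have [K [Z [_ [GK ZK _]]]] := pairing_mx_factor; exists K, Z.
have [K [Z [GK ZK]]] := factor d d e1 e2.
have [_ uK] := mulmx1_unit ZK.
exists (\det K) => [|I J]; first by rewrite -unitfE -unitmxE.
rewrite !pluckerE GK mxsub_mul det_mulmx -[rowsub _ _]/(mxsub (val I) id _) mxsub_mul det_mulmx.
have -> : mxsub (val I) id (coord_mx d (limg T))^T = (colsub (val I) (coord_mx d (limg T)))^T.
  by apply/matrixP => a b; rewrite !mxE.
by rewrite det_tr mxsub_id [\det K * _]mulrC.
Qed.
End TransposedMinors.

Lemma plucker_neq0 (k : fieldType) (W : vectType k) d (X : {vspace W}) :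
  \dim X = d -> plucker d X != 0.
Proof.
move=> <-; have [J] := row_free_increasing (coord_mx_free X).
by apply: contraNneq => p0; rewrite -pluckerE p0 ffunE.
Qed.

(** * Powers of a generic element *)

Section ModulePowers.
Variables (k : fieldType) (E : finGroupScheme k).
Implicit Type M : emodule E.

Lemma op_powE M j u : op_pow M j u = mact M (u ^+ j).
Proof. by elim: j => [|j IH]; rewrite ?expr0 ?mact1 // exprS mactM -IH. Qed.

Lemma antipodeMX (u : measures E) j : antipodeM (u ^+ j) = antipodeM u ^+ j.
Proof. by elim: j => [|j IH]; rewrite ?expr0 ?antipodeM1 // exprS exprSr antipodeMM IH. Qed.

Lemma op_pow_dual M j u (phi : 'Hom(M, k^o)) :
  op_pow (dual_module M) j u phi = (phi \o op_pow M j (antipodeM u))%VF.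
Proof. by rewrite !op_powE -antipodeMX /= lfunE. Qed.

Lemma op_pow_poly (V : vectType k) (L : {linear V -> measures E}) M j w i :
  exists P : {mpoly k[\dim {:V}]}, P \is j.-homog /\
    forall x, P.@[coords x] = coords (op_pow M j (L x) w) i.
Proof.
elim: j i => [|j IH] i.
  exists (coords w i *: 1); split; first by rewrite rpredZ // dhomog1.
  by move=> x; rewrite mevalZ meval1 mulr1 /op_pow /= id_lfunE.
have [P PE] := choice _ IH.
pose Q c : {mpoly k[\dim {:V}]} :=
  \sum_(l < \dim {:V}) coords (mact M (L (vbasis {:V})`_l) (vbasis {:M})`_c) i *: 'X_l.
exists (\sum_(c < \dim {:M}) P c * Q c); split.
  apply: rpred_sum => c _; rewrite -addn1; apply: dhomogM; first by case: (PE c).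
  by apply: rpred_sum => l _; rewrite rpredZ // dhomogX /= mdeg1.
move=> x; transitivity (\sum_c (P c * Q c).@[coords x]); first exact: raddf_sum.
have -> : op_pow M j.+1 (L x) w = mact M (L x) (op_pow M j (L x) w) by rewrite [LHS]comp_lfunE.
rewrite [in RHS](coord_vbasis (memvf (op_pow M j (L x) w))) linear_sum /coords linear_sum.
apply: eq_bigr => c _; rewrite mevalM (PE c).2 !linearZ /=; congr (_ * _).
rewrite raddf_sum /= [in RHS](coord_vbasis (memvf x)) !linear_sum sum_lfunE linear_sum.
by apply: eq_bigr => l _; rewrite mevalZ mevalXU !linearZ scale_lfunE linearZ /= mulrC.
Qed.
End ModulePowers.

Lemma det_homog (k : fieldType) n d j (B : 'M[{mpoly k[n]}]_d) :
  (forall a b, B a b \is j.-homog) -> \det B \is (j * d).-homog.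
Proof.
move=> hB; apply: rpred_sum => s _; rewrite rpredMsign.
have -> : (j * d = \sum_(i < d) j)%N by rewrite sum_nat_const card_ord mulnC.
elim/big_rec2: _ => [|i x y _ hy]; first exact: dhomog1.
exact: dhomogM.
Qed.

Section ExtCoords.
Variables (k : fieldType) (d : nat) (W : vectType k).

Definition ext_delta (I : increasing d (\dim {:W})) : extPower d W := [ffun J => (J == I)%:R].

Lemma ext_coords (v : extPower d W) a :
  coords v a = \sum_I (v : {ffun _ -> _}) I * coords (ext_delta I) a.
Proof.
have {1}-> : v = \sum_I ((v : {ffun _ -> _}) I : k) *: ext_delta I.
  apply/ffunP => J; rewrite sum_ffunE (bigD1 J) //= !ffunE eqxx [_ *: 1]mulr1 big1 ?addr0 //.
  by move=> I ne; rewrite !ffunE eq_sym (negPf ne) scaler0.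
by rewrite /coords linear_sum; apply: eq_bigr => I _; rewrite linearZ.
Qed.
End ExtCoords.

Lemma has_degree_ext (k : fieldType) (V W : vectType k) (U : V -> Prop) (phi psi : V -> W) d :
  phi =1 psi -> has_degree U phi d -> has_degree U psi d.
Proof.
move=> e [f [fh fg fphi]]; exists f; split=> // x x0 Ux; rewrite -e; exact: fphi.
Qed.

Section JRankConst.
Variables (k : fieldType) (p : nat) (E : finGroupScheme k) (M : emodule E) (j : nat).

Lemma jrank_const r : (exists alpha : ppoint p E, True) ->
  (forall alpha : ppoint p E, lfun_rank (op_pow M j (ppoint_t alpha)) = r) -> jrank p M j = r.
Proof.
case=> alpha _ h; have rM : (r < (\dim {:M}).+1)%N by rewrite ltnS -(h alpha) dimvS ?subvf.
apply/eqP; rewrite eqn_leq /jrank; apply/andP; split.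
  apply/bigmax_leqP => d; case: excluded_middle_informative => // -[beta e] _.
  by rewrite -e h.
apply: (@leq_bigmax_cond _ _ (fun d : 'I_(\dim {:M}).+1 => d : nat) (Ordinal rM)).
case: excluded_middle_informative => // -[]; by exists alpha.
Qed.

Lemma jrank_none : ~ (exists alpha : ppoint p E, True) -> jrank p M j = 0%N.
Proof.
move=> h; rewrite /jrank big1 // => d; case: excluded_middle_informative => // -[alpha _] _.
by case: h; exists alpha.
Qed.
End JRankConst.

(** * Generators of the radical, and the degree formula *)

Section Generators.
Variables (k : fieldType) (p : nat) (charp : p \in [pchar k]) (E : finGroupScheme k).
Local Notation A := (measures E).
Local Notation R := (Rad (measures E)).
Hypothesis comm : forall u v : A, u * v = v * u.
Hypothesis ht1 : forall u : A, height1 p u.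

Let RadE (u : A) : (u \in R) = (aug u == 0). Proof. exact: (Rad_aug charp ht1). Qed.

Lemma Rad_mull (u v : A) : v \in R -> u * v \in R.
Proof. by rewrite !RadE augM => /eqP->; rewrite mulr0. Qed.

Lemma Rad2_sub : (R * R <= R)%VS.
Proof. by apply/prodvP => u v _; exact: Rad_mull. Qed.

Lemma Rad_antipode (u : A) : u \in R -> antipodeM u \in R.
Proof. by rewrite !RadE aug_antipodeM. Qed.

Lemma Rad2_antipode (u : A) : u \notin (R * R)%VS -> antipodeM u \notin (R * R)%VS.
Proof.
apply: contra; rewrite -{2}(antipodeMK u); move: (antipodeM u) => v.
have /subvP sub : (R * R <= linfun (@antipodeM k E) @^-1: (R * R))%VS.
  apply/prodvP => a b aR bR; rewrite -memv_preim lfunE /= antipodeMM.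
  by rewrite memv_mul ?Rad_antipode.
by move/sub; rewrite -memv_preim lfunE.
Qed.

Lemma ppoint_in_Rad (alpha : ppoint p E) : ppoint_t alpha \in R.
Proof.
have p_gt0 : (0 < p)%N by exact: prime_gt0 (pcharf_prime charp).
rewrite RadE; have : aug (ppoint_t alpha ^+ p) = 0.
  by rewrite /ppoint_t -rmorphXn truncX_nil // rmorph0 linear0.
have augX n : aug (ppoint_t alpha ^+ n) = aug (ppoint_t alpha) ^+ n.
  by elim: n => [|n IH]; rewrite ?expr0 ?aug1 // !exprS augM IH.
by rewrite augX => /eqP; rewrite expf_eq0 => /andP[].
Qed.

(* Nakayama: the generators of R are removed one at a time. *)
Lemma Rad_eq0 : nb_generators E = 0%N -> R = 0%VS.
Proof.
move=> nb0; have RR : (R * R = R)%VS.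
  by apply/eqP; rewrite eqEdim Rad2_sub -subn_eq0 -/(nb_generators E) nb0.
pose J (s : seq A) : {vspace A} := (\sum_(y <- s) fullv * <[y]>)%VS.
have JI s u v : v \in J s -> u * v \in J s.
  have /prodvP h : (fullv * J s <= J s)%VS; last by move=> vJ; apply: h; rewrite ?memvf.
  rewrite /J; elim: s => [|y s IH]; first by rewrite !big_nil prodv0 subvv.
  rewrite !big_cons prodvDr; apply: addvS; last exact: IH.
  by rewrite prodvA prodvSl // subvf.
suff H s : all (fun y => y \in R) s -> (R <= J s)%VS -> (R <= 0)%VS.
  have /H : all (fun y => y \in R) (vbasis R) by apply/allP => y; exact: vbasis_mem.
  move=> h; apply/eqP; rewrite -subv0; apply: h; apply/subvP => u uR.
  rewrite (coord_vbasis uR); apply: memv_suml => i _; apply: memvZ.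
  apply: (@subvP _ _ (fullv * <[(vbasis R)`_i]>)%VS).
    rewrite /J (big_nth 0) big_mkord size_tuple.
    exact: (sumv_sup i).
  by have := memv_mul (memvf (1 : A)) (memv_line (vbasis R)`_i); rewrite mul1r.
elim: s => [|y s IH] /=; first by rewrite /J big_nil.
case/andP=> yR sR RJ; apply: IH => //.
(* From [R = R R] and the inclusion of [R] in [J (y :: s)] one gets [y = r y + b] with [r] in [R]
   and [b] in [J s]; and [1 - r] is a unit. *)
have yJ : y \in J s.
  have : y \in (R * <[y]> + J s)%VS.
    have /subvP : (R <= R * <[y]> + J s)%VS; last by apply.
    rewrite -{1}RR; apply: subv_trans (prodvSr R RJ) _.
    rewrite /J big_cons prodvDr prodvA; apply: addvS.
      apply/prodvSl/prodvP => a b aR _; rewrite comm; exact: Rad_mull.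
    by apply/prodvP => a b _; exact: JI.
  case/memv_addP => z zR [b bJ e].
  have [r rR zr] : exists2 r, r \in R & z = r * y.
    have /subvP/(_ z zR)/memv_imgP[r rR ->] : (R * <[y]> <= linfun (y \o* idfun) @: R)%VS.
      apply/prodvP => a c aR /vlineP[t ->]; apply/memv_imgP; exists (t *: a); first exact: memvZ.
      by rewrite lfunE /= -scalerAl -scalerAr.
    by exists r => //; rewrite lfunE.
  have [v vE] : exists v, v * (1 - r) = 1.
    apply: (aug_neq0_unit charp ht1); rewrite linearB /= aug1.
    by move: rR; rewrite RadE => /eqP->; rewrite subr0 oner_eq0.
  rewrite -[y]mul1r -vE -mulrA; apply: JI.
  by rewrite mulrBl mul1r -zr {1}e addrC addKr.
apply: subv_trans RJ _; rewrite /J big_cons subv_add; apply/andP; split=> //.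
by apply/prodvP => a b _ /vlineP[c ->]; apply: JI; exact: memvZ.
Qed.

Lemma two_generators : (1 < nb_generators E)%N -> exists e1 e2 : subvs_of R,
  (forall t, vsval (e1 + t *: e2) \notin (R * R)%VS) /\
  (forall t, vsval (e2 + t *: e1) \notin (R * R)%VS).
Proof.
(* No non-zero vector of a complement of [Rad^2] in [Rad] lies in [Rad^2], so any two of its basis
   vectors will do. *)
move=> nb; pose C := (R :\: (R * R))%VS.
have dC : (1 < \dim C)%N.
  have := dimv_cap_compl R (R * R)%VS; rewrite (capv_idPr Rad2_sub) => e.
  by rewrite (leq_trans nb) // /nb_generators -e addKn.
pose b (i : 'I_(\dim C)) := (vbasis C)`_i.
have bC i : b i \in C by apply: vbasis_mem; rewrite mem_nth // size_tuple.
have bR i : b i \in R by apply: (subvP (diffvSl _ _)) (bC i).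
have key i i' t : i != i' -> b i + t *: b i' \notin (R * R)%VS.
  move=> ne; apply/negP => h.
  have : b i + t *: b i' \in (C :&: (R * R))%VS by rewrite memv_cap h andbT rpredD // memvZ.
  rewrite capv_diff memv0 => /eqP e.
  have fC : free (vbasis C) by exact: basis_free (vbasisP _).
  have := congr1 (coord (vbasis C) i) e; rewrite linearD linearZ linear0 /= !coord_free //.
  rewrite eqxx eq_sym (negPf ne) mulr0 addr0 => /eqP; by rewrite oner_eq0.
pose i0 : 'I_(\dim C) := Ordinal (ltnW dC); pose i1 : 'I_(\dim C) := Ordinal dC.
exists (vsproj R (b i0)), (vsproj R (b i1)).
by split=> t; rewrite linearD linearZ /= !vsprojK ?key.
Qed.

(** On the dual, a p-point acts by the transpose of its composite with the antipode, which is again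
    a p-point, and transposes have equal rank. *)
Lemma jrank_dual (M : emodule E) j : constant_jrank p M j ->
  jrank p (dual_module M) j = jrank p M j.
Proof.
move=> cst; case: (classic (exists alpha : ppoint p E, True)) => [ex|nex]; last by rewrite !jrank_none.
apply: jrank_const => // alpha; have [beta betaE] := ppoint_antipode alpha comm.
have [w wE] := dual_family M.
rewrite -(cst beta) betaE; apply: (@dim_limg_dual k M _ _ w) => // phi.
exact: op_pow_dual.
Qed.
End Generators.

(** [E_rank] excludes the case in which [Rad^2] is a hyperplane of [Rad], where [g] may be a power
    of its equation. There the formula can fail: if [kE] is [k[X]/(X^p)] and [M] is [kE] itself,
    every element of [Rad] off [Rad^2] is a unit times [X], so the images are constant and both
    degrees are 0, while the [j]-rank is [p - j]. *)
Theorem theorem6p2p5 (k : closedFieldType) (p : nat) (charp : p \in [pchar k])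
    (E : finGroupScheme k) (E_elem : elementary_abelian charp E)
    (E_rank : nb_generators E != 1%N)
    (j : nat) (j_bounds : (1 <= j <= p - 1)%N)
    (M : emodule E) (M_cst : constant_jrank p M j) :
  (jdegree p M j + jdegree p (dual_module M) j = j * jrank p M j)%N.
Proof.
have [comm _] := E_elem.
have ht1 (u : measures E) : height1 p u by exact: elementary_abelian_height1 E_elem.
have j_gt0 : (0 < j)%N by case/andP: j_bounds.
have dualE := jrank_dual comm M_cst; rewrite /jdegree dualE.
have [->|d0] := eqVneq (jrank p M j) 0%N; first by rewrite muln0.
set d := jrank p M j in d0 *.
(* Without generators the radical is 0, so all p-points send [t] to 0 and the [j]-rank is 0, against
   [d0]. *)
have nb : (1 < nb_generators E)%N.
  case: (nb_generators E) E_rank (Rad_eq0 charp comm ht1) => [_ /(_ erefl) R0|[]] //.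
  case/eqP: d0; rewrite /d; case: (classic (exists alpha : ppoint p E, True)) => [ex|]; last exact: jrank_none.
  apply: jrank_const => // alpha; have := ppoint_in_Rad charp ht1 alpha.
  rewrite R0 memv0 => /eqP ->; rewrite op_powE expr0n gtn_eqF // linear0 /lfun_rank.
  by rewrite (_ : limg 0 = 0%VS) ?dimv0 //; apply/eqP; rewrite -subv0 lim0g.
have [e1 [e2 [e1W e2W]]] := two_generators charp ht1 nb.
pose R := Rad (measures E); pose V := subvs_of R.
pose W : {vspace V} := (linfun (@vsval _ _ R) @^-1: (R * R))%VS.
have memW x : (x \in W) = (vsval x \in (R * R)%VS) by rewrite -memv_preim lfunE.
have e1V t : e1 + t *: e2 \notin W by rewrite memW.
have e2V t : e2 + t *: e1 \notin W by rewrite memW.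
have UW (x : V) : UE x <-> x \notin W by rewrite memW.
(* The power of [x] on the dual is the transpose of the power of [L x] on [M]; so the minors at [x]
   are taken for [L x], and [phi1] is twisted by [s] accordingly. *)
pose L : {linear V -> measures E} := @antipodeM k E \o @vsval _ _ R.
pose s : {linear V -> V} := vsproj R \o L.
have sE x : vsval (s x) = antipodeM (vsval x).
  by rewrite /= vsprojK // (Rad_antipode charp ht1) // subvsP.
have sK : involutive s by move=> x; apply: val_inj; rewrite /= -[val]/(@vsval _ _ R) !sE antipodeMK.
have sU x : UE x -> UE (s x) by rewrite /UE sE; exact: (Rad2_antipode charp ht1).
have rank_at x : UE x -> \dim (limg (op_pow M j (L x))) = d.
  move=> /sU; rewrite /UE sE => Ux.
  have [|alpha e] := ppoint_of_Rad charp comm ht1 _ Ux; last by rewrite -[L x]e -[RHS](M_cst alpha).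
  by rewrite (Rad_antipode charp ht1) // subvsP.
pose phi1 (x : V) := plucker d (ImM M j (s x)).
pose phi2 (x : V) := plucker d (ImM (dual_module M) j x).
have [w wE] := dual_family M.
have [P PE] := choice _ (fun l => choice _ (fun i => op_pow_poly L j (w l) i)).
pose minor (I : increasing d (\dim {:M})) (J : increasing d (\dim {:'Hom(M, k^o)})) :=
  \det (\matrix_(a, b) P (val J b) (val I a)).
(* The matrix of minors in the bases [vbasis] of the two exterior powers. *)
pose C a b := \sum_I \sum_J (coords (ext_delta I : extPower d M) a *
  coords (ext_delta J : extPower d 'Hom(M, k^o)) b) *: minor I J.
have C_homog a b : C a b \is (j * d).-homog.
  apply: rpred_sum => I _; apply: rpred_sum => J _; apply: rpredZ; apply: det_homog => a' b'.
  by rewrite mxE; case: (PE (val J b') (val I a')).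
have C_phi x : UE x -> exists c, [/\ c != 0, phi1 x != 0, phi2 x != 0
    & forall a b, (C a b).@[coords x] = c * coords (phi1 x) a * coords (phi2 x) b].
  move=> Ux; have T'E := @op_pow_dual k E M j (vsval x).
  have [c c0 cE] := pairing_minors T'E wE (rank_at x Ux).
  have p1 : phi1 x = plucker d (limg (op_pow M j (L x))) by rewrite /phi1 /ImM sE.
  exists c; split=> //.
  - by rewrite p1 plucker_neq0 // rank_at.
  - by rewrite plucker_neq0 // [LHS](dim_limg_dual T'E wE) rank_at.
  move=> a b; rewrite !ext_coords raddf_sum [c * _]mulr_sumr mulr_suml; apply: eq_bigr => I _.
  rewrite raddf_sum mulr_sumr; apply: eq_bigr => J _ /=; rewrite mevalZ.
  have -> : (minor I J).@[coords x] = c * (phi1 x : {ffun _ -> _}) I * (phi2 x : {ffun _ -> _}) J.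
    rewrite p1 -cE /minor -det_map_mx; congr (\det _).
    by apply/matrixP => a' b'; rewrite !mxE; exact: (PE _ _).2.
  ring.
have deg1 : exists n, has_degree (@UE k E) phi1 n.
  exact: (degree_exists UW e1V C_homog C_phi).
have deg2 : exists n, has_degree (@UE k E) phi2 n.
  apply: (degree_exists UW e1V (C := fun b a => C a b) (phi2 := phi1)) => // x Ux.
  have [c [c0 p1 p2 e]] := C_phi x Ux; exists c; split=> // b a; rewrite e; ring.
pose phi (x : V) := plucker d (ImM M j x).
have degM : exists n, has_degree (@UE k E) phi n.
  have [n hn] := deg1; exists n; apply: (has_degree_ext _ (has_degree_comp sK sK sU hn)) => x.
  by rewrite /= /phi1 sK.
(* [phi1] is [phi] composed with [s], so the number that [epsilon] selects for [phi] is also a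
   degree of [phi1]. *)
apply: (degree_sum UW e1V e2V C_homog C_phi).
- exact: (has_degree_comp sK sK sU (epsilon_spec _ _ degM)).
- exact: (epsilon_spec _ _ deg2).
Qed.
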